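(* Let $D$ be a link diagram containing one side of a third Reidemeister move with crossings $a,b,c$ as described in the context, and let $\operatorname{in}\circ\rho_3:\mathcal C(D)\to\mathcal C(D)$ be the map $\rho_3$ of the context followed by the inclusion $\operatorname{in}$. Define an $R$-linear map $h_3:\mathcal C(D)\to\mathcal C(D)$ by $$h_3\bigl(E_{--+}(p,q,r)\otimes[xab]\bigr)=-E^{-}_{+-+}(p,q,r)\otimes[xb],\qquad h_3\bigl(E^{+}_{+-+}(p,q,r)\otimes[xb]\bigr)=E_{+++}(p,q,r)\otimes[x],$$ and $h_3=0$ on all generators of the other types. Then $$\delta_{s,t}\circ h_3+h_3\circ\delta_{s,t}=\operatorname{id}-\operatorname{in}\circ\rho_3 ,$$ i.e. $h_3$ is a chain homotopy connecting $\operatorname{in}\circ\rho_3$ to the identity.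
   Context: **The complex.** Let $R=\mathbb Z[s,t]$ and let $D$ be an oriented link diagram. At each crossing a marker is chosen: the positive marker is the $A$-smoothing and the negative marker is the $A^{-1}$-smoothing of the Kauffman bracket $\langle D_\times\rangle=A\langle D_0\rangle+A^{-1}\langle D_\infty\rangle$. An enhanced state $S$ is a choice of a marker at each crossing together with a sign $+$ or $-$ on each circle of the smoothed diagram (state circle). An oriented enhanced state is $S\otimes[x]$ where $x$ is a sequence listing each negative-marker crossing of $S$ exactly once; if $x'$ is a permutation of $x$ then $S\otimes[x']=\pm S\otimes[x]$, with sign the sign of the permutation. $\mathcal C(D)=\bigoplus_i\mathcal C^i(D)$ is the free $R$-module generated by oriented enhanced states modulo these relations; $\mathcal C^i(D)$ is spanned by states with $i(S)=(w(D)-\sigma(S))/2=i$, where $w(D)$ is the writhe and $\sigma(S)$ is the number of positive markers minus the number of negative markers. Let $V$ be the free $R$-module on the signs $+,-$, with commutative bilinear product $m(+:+)=s\,(+)+t\,(-)$, $m(+:-)=m(-:+)=+$, $m(-:-)=-$, and coproduct $\Delta(+)=(+)\otimes(+)+t\,(-)\otimes(-)$, $\Delta(-)=(+)\otimes(-)+(-)\otimes(+)-s\,(-)\otimes(-)$. The map $\delta_{s,t}:\mathcal C^i(D)\to\mathcal C^{i+1}(D)$ is $\delta_{s,t}(S\otimes[x])=\sum_a S_a\otimes[xa]$, the sum over crossings $a$ with positive marker in $S$, where $S_a$ is the combination of enhanced states obtained by making the marker at $a$ negative: if two circles with signs $p,q$ merge, the new circle is labelled $m(p:q)$; if a circle with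 sign $p$ splits, the two new circles are labelled by $\Delta(p)$; other signs are unchanged. Labels are extended $R$-linearly. It is known that $\delta_{s,t}^2=0$. **The local picture.** Inside a disk with boundary points $T_1,T_2,T_3$ on top and $B_1,B_2,B_3$ on the bottom (left to right), $D$ consists of three strands: $T_1$–$B_3$ (top-most), $T_2$–$B_2$ (middle), $B_1$–$T_3$ (lowest). The crossings are: $c$ (upper left) between $T_1B_3$ and $T_2B_2$; $a$ (lower left) between $T_2B_2$ and $B_1T_3$; $b$ (right) between $T_1B_3$ and $B_1T_3$. So $T_1B_3$ meets $c$ then $b$; $T_2B_2$ meets $c$ then $a$; $B_1T_3$ meets $a$ then $b$. At each of $a,b,c$ the horizontal smoothing $\asymp$ is positive and the vertical smoothing $)($ is negative. Let $x$ be a sequence of the negative-marker crossings outside the disk. A symbol $\alpha\beta\gamma$ records the markers at $a,b,c$. Generators of $\mathcal C(D)$ with $c$ positive: - $E_{+++}(p,q,r)\otimes[x]$ and $E_{--+}(p,q,r)\otimes[xab]$: arcs $T_3B_3$, $B_1B_2$, $T_1T_2$ labelled $p,q,r$ respectively. - $E^{\epsilon}_{+-+}(p,q,r)\otimes[xb]$, $\epsilon=\pm$: arcs $T_3B_3$, $B_1B_2$, $T_1T_2$ labelled $p,q,r$, and a small circle inside the disk with sign $\epsilon$. - $E_{-++}(p,q,r)\otimes[xa]$: arcs $B_1T_3$, $B_2B_3$, $T_1T_2$ labelled $p,q,r$. The generators with $c$ negative are the $E_{**-}\otimes[yc]$, where the markers at $a,b$ and all signs are arbitrary and $y$ lists all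 the other negative-marker crossings. In particular $E_{+--}(p,q,r)\otimes[xbc]$ has arcs $T_3B_3,B_1B_2,T_1T_2$ labelled $p,q,r$, and $E_{++-}\otimes[xc]$ has arcs $T_2T_3$, $T_1B_3$, $B_1B_2$. The label of an arc is the sign of the state circle containing it (arcs on the same circle have equal labels); everything outside the disk (markers, and signs of circles not meeting the disk) is arbitrary and the same in all terms of a formula. **Notation.** If two arcs with labels $p,q$ are replaced via a saddle, the new arcs are labelled $p:q$ and $q:p$; an expression containing these labels denotes the $R$-linear combination of enhanced states obtained by the merge (via $m$) or split (via $\Delta$) of the state circles involved. The label $\tilde r$ of a further arc is $r$ if its circle is not involved in the saddle, and otherwise the label inherited from the resulting circle. $\tilde{\tilde r}$ and $(p:q):(q:p)$ refer to performing the saddle twice, i.e. the saddle followed by its reverse. **The map $\rho_3$.** The $R$-linear map $\rho_3$ on $\mathcal C(D)$ is given by: - $E_{-++}(p,q,r)\otimes[xa]\mapsto E_{-++}(p,q,r)\otimes[xa]+E^{-}_{+-+}(p:q,\,q:p,\,\tilde r)\otimes[xb]$ (saddle $\{B_1T_3,B_2B_3\}\to\{T_3B_3,B_1B_2\}$); - $E_{**-}\otimes[yc]\mapsto E_{**-}\otimes[yc]$; - $E^{+}_{+-+}(p,q,r)\otimes[xb]\mapsto -E_{-++}(p:q,\,q:p,\,\tilde r)\otimes[xa]-E^{-}_{+-+}\bigl((p:q):(q:p),\,(q:p):(p:q),\,\tilde{\tilde r}\bigr)\otimes[xb]-E_{++-}\otimes[xc]$, where in the first two terms the saddle is $\{T_3B_3,B_1B_2\}\to\{B_1T_3,B_2B_3\}$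 (performed, and then reversed in the second term), and in the last term $E_{++-}$ has labels $p:r$ on $T_2T_3$, $r:p$ on $T_1B_3$, $\tilde q$ on $B_1B_2$, obtained by the saddle $\{T_3B_3,T_1T_2\}\to\{T_2T_3,T_1B_3\}$; - $E_{--+}(p,q,r)\otimes[xab]\mapsto E_{+--}(p,q,r)\otimes[xbc]$; - all other generators $\mapsto 0$. Its image is the submodule $\mathcal C$ generated by all $E_{-++}(p,q,r)\otimes[xa]+E^{-}_{+-+}(p:q,q:p,\tilde r)\otimes[xb]$ and all $E_{**-}\otimes[yc]$. *)

(* Defs.v *)
From HB Require Import structures.
From mathcomp Require Import all_boot all_order all_algebra all_fingroup.
From mathcomp.multinomials Require Import mpoly.

Set Implicit Arguments.
Unset Strict Implicit.
Unset Printing Implicit Defensive.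

Import GRing.Theory.
Local Open Scope ring_scope.

(** The construction is written over an arbitrary commutative ring [R] with two
    elements [s] and [t]; the universal case is [R = Z[s, t]]. *)
Definition ZST : comNzRingType := {mpoly int[2]}.
Definition var_s : ZST := 'X_(inord 0 : 'I_2).
Definition var_t : ZST := 'X_(inord 1 : 'I_2).

(** Planar diagram codes.  The four ends of a crossing [x] are the darts
    [(x, 0), ..., (x, 3)], in counterclockwise order, [(x, 0)] being the
    incoming end of the lower strand.  So the lower strand runs from 0 to 2 and
    the upper strand joins 1 and 3; it runs from 3 to 1 iff [x] is a positive
    crossing (positive in the sense of the writhe).  The edges of the diagram
    are the pairs [{d, glue d}].  [loops] counts the components of the diagram
    without crossings.

    [planar] is Euler's formula V - E + F = 2 C, with E = 2 V, C the number of
    connected components of the underlying 4-valent graph and F the number of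
    faces of the cellular surface defined by the code: that surface is then a
    disjoint union of spheres. *)

Section Darts.
Variables (V : finType) (pos : V -> bool) (g : V * 'Z_4 -> V * 'Z_4).

Definition rot_dart (d : V * 'Z_4) : V * 'Z_4 := (d.1, d.2 + 1).

Definition outgoing (d : V * 'Z_4) : bool :=
  (d.2 == 2) || (d.2 == if pos d.1 then 1 else 3).

Definition face_step (d : V * 'Z_4) : V * 'Z_4 := rot_dart (g d).

Definition dart_adj : rel (V * 'Z_4) :=
  [rel d d' | (d' == rot_dart d) || (d' == g d)].

End Darts.

Record link_diagram := LinkDiagram {
  crossing : finType;
  positive : crossing -> bool;
  glue : crossing * 'Z_4 -> crossing * 'Z_4;
  loops : nat;
  glueK : involutive glue;
  glue_outgoing : forall d, outgoing positive (glue d) = ~~ outgoing positive d;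
  planar : fcard (face_step glue) predT
           = (#|crossing| + 2 * n_comp (dart_adj glue) predT)%N
}.

Lemma perm_eq_map (T : finType) (x e : seq T) : uniq e -> perm_eq x e ->
  exists2 p : {perm T}, perm_on [set y in e] p & x = map p e.
Proof.
move=> Ue Hx.
have Ux : uniq x by rewrite (perm_uniq Hx).
have xE y : (y \in x) = (y \in e) by rewrite (perm_mem Hx).
have szE : size x = size e by apply: perm_size.
pose f y := if y \in e then nth y x (index y e) else y.
have fx y : (f y \in x) = (y \in x).
  rewrite [RHS]xE /f; case: ifP => ye; last by rewrite xE.
  by rewrite mem_nth // szE index_mem.
have f_inj : injective f.
  move=> y y' Ef; have := fx y; rewrite Ef fx !xE => ye.
  move: Ef; rewrite /f -ye; case: ifP ye => // ye ye'.
  rewrite (set_nth_default y) ?szE ?index_mem -?ye' //.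
  move/eqP; rewrite nth_uniq ?szE ?index_mem -?ye' // => /eqP.
  by apply: index_inj.
exists (perm f_inj).
  by apply/subsetP => y; rewrite !inE permE /f; case: ifP => // _; rewrite eqxx.
case E: e => [|y0 e']; first by apply: size0nil; rewrite szE E.
rewrite -E; apply: (@eq_from_nth _ y0) => [|i Hi]; first by rewrite size_map.
rewrite szE in Hi; rewrite (nth_map y0) // permE /f mem_nth // index_uniq //.
by apply: set_nth_default; rewrite szE.
Qed.

Section Complex.
Variable D : link_diagram.

Definition dart : finType := (crossing D * 'Z_4)%type.
Definition point : finType := (dart + 'I_(loops D))%type.

Definition writhe : int := \sum_(x : crossing D) (if positive x then 1 else -1).

(** [true] is the positive marker.  The A-smoothing merges the two regions
    swept out by the upper strand when it is turned counterclockwise, so it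
    joins the ends 0, 1 and the ends 2, 3; the other one joins 1, 2 and 3, 0. *)
Definition smooth (m : {ffun crossing D -> bool}) (d : dart) : dart :=
  (d.1, if odd d.2 (+) m d.1 then d.2 + 1 else d.2 - 1).

Definition arc_adj (m : {ffun crossing D -> bool}) : rel point :=
  fun u v => match u, v with
  | inl d, inl d' => (d' == glue d) || (d' == smooth m d)
  | _, _ => false
  end.

Definition same_circle m : rel point := connect (arc_adj m).

(** A sign on each state circle ([true] is +) is a function on points that is
    constant on each circle. *)
Definition is_estate
    (S : {ffun crossing D -> bool} * {ffun point -> bool}) : bool :=
  [forall u, forall v, same_circle S.1 u v ==> (S.2 u == S.2 v)].

Record estate := Estate {
  estate_val : {ffun crossing D -> bool} * {ffun point -> bool};
  estateP : is_estate estate_val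
}.

HB.instance Definition _ := [isSub for estate_val].
HB.instance Definition _ := [Countable of estate by <:].

(** Opaque, so that unification does not try to enumerate the states. *)
Fact estate_finite : isFinite estate.
Proof.
exact: [Finite of estate by <:].
Qed.
HB.instance Definition _ := estate_finite.

Definition mark (S : estate) : {ffun crossing D -> bool} := (estate_val S).1.
Definition sgn (S : estate) (u : point) : bool := (estate_val S).2 u.

Definition negs (S : estate) : {set crossing D} := [set x | ~~ mark S x].

Variables (R : comNzRingType) (s t : R).

(** [S (x) [x]] and [S (x) [x']] only differ by a sign, so C(D) is the free
    module on the states, [S] standing for [S (x) [enum (negs S)]].  Lemmas
    [gen_map] and [chain_universal] show that this is the module generated by
    the [gen S x] subject to the sign relations. *)
Definition chain : lmodType R := {ffun estate -> R^o}.

Definition basis (S : estate) : chain := [ffun S' => (S' == S)%:R].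

(** [gen S x] is [S (x) [x]]; it is 0 unless [x] lists every element of
    [negs S] exactly once. *)
Definition gen (S : estate) (x : seq (crossing D)) : chain :=
  if [pick p : {perm crossing D} |
       perm_on (negs S) p && (x == map p (enum (negs S)))] is Some p
  then (-1) ^+ p *: basis S else 0.

Definition listing (S : estate) (x : seq (crossing D)) : bool :=
  perm_eq x (enum (negs S)).

(** The linear map with [gen S (l S) |-> F S], where [l S] lists [negs S]. *)
Definition lin_lift (l : estate -> seq (crossing D)) (F : estate -> chain)
    (z : chain) : chain :=
  \sum_(S : estate) z S *: (gen S (l S) S *: F S).

Lemma gen_map (S : estate) (p : {perm crossing D}) x :
  perm_on (negs S) p -> gen S (map p x) = (-1) ^+ p *: gen S x.
Proof.
have uniq_p (q q' : {perm crossing D}) : perm_on (negs S) q ->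
    perm_on (negs S) q' -> map q (enum (negs S)) = map q' (enum (negs S)) ->
  q = q'.
  move=> Hq Hq' /eq_in_map E; apply/permP => y.
  have [yN|yN] := boolP (y \in negs S); first by apply: E; rewrite mem_enum.
  by rewrite (out_perm Hq yN) (out_perm Hq' yN).
move=> Hp; rewrite /gen.
case: pickP => [q /andP[Hq /eqP Eq]|H1]; case: pickP => [r /andP[Hr /eqP Er]|H2].
- suff -> : q = (r * p)%g by rewrite odd_permM addbC signr_addb scalerA.
  apply: uniq_p => //; first exact: perm_onM.
  rewrite -Eq Er -map_comp; apply: eq_map => y; by rewrite /= permM.
- case/negP: (negbT (H2 (q * p^-1)%g)); apply/andP; split.
    by apply: perm_onM => //; apply: perm_onV.
  apply/eqP; apply: (inj_map (@perm_inj _ p)); rewrite Eq -map_comp; apply: eq_map => y.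
  by rewrite /= permM permKV.
- case/negP: (negbT (H1 (r * p)%g)); apply/andP; split; first exact: perm_onM.
  by apply/eqP; rewrite Er -map_comp; apply: eq_map => y; rewrite /= permM.
- by rewrite scaler0.
Qed.

Lemma gen_enum (S : estate) : gen S (enum (negs S)) = basis S.
Proof.
rewrite /gen; case: pickP => [q /andP[Hq /eqP Eq]|H1]; last first.
  case/negP: (negbT (H1 1%g)); apply/andP; split; first exact: perm_on1.
  apply/eqP; rewrite -[LHS]map_id.
  by apply: eq_map => y; rewrite perm1.
suff -> : q = 1%g by rewrite odd_perm1 expr0 scale1r.
apply/permP => y; rewrite perm1.
have [yN|yN] := boolP (y \in negs S); last by rewrite (out_perm Hq yN).
have := yN; rewrite -mem_enum -{1}[enum _]map_id in Eq *.
by move/eq_in_map: Eq => /[apply].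
Qed.

Lemma gen_listing S x : listing S x ->
  exists2 p : {perm crossing D}, perm_on (negs S) p
    & x = map p (enum (negs S)) /\ gen S x = (-1) ^+ p *: basis S.
Proof.
case/(perm_eq_map (enum_uniq _)) => p; rewrite set_enum => Hp ->; exists p => //.
by rewrite gen_map // gen_enum.
Qed.

Lemma basisE S S' : basis S S' = (S' == S)%:R.
Proof. by rewrite ffunE. Qed.

Lemma chainDE (u v : chain) S : (u + v) S = u S + v S.
Proof. by rewrite ffunE. Qed.

Lemma chainZE k (u : chain) S : (k *: u) S = k * u S.
Proof. by rewrite ffunE. Qed.

Lemma chain_sumE (I : finType) (P : pred I) (F : I -> chain) S :
  (\sum_(i | P i) F i) S = \sum_(i | P i) F i S.
Proof.
exact: (big_morph (fun z : chain => z S) (fun u v => chainDE u v S) (ffunE _ _)).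
Qed.

Lemma chain_decomp (z : chain) : z = \sum_S z S *: basis S.
Proof.
apply/ffunP => S; rewrite chain_sumE (bigD1 S) //= chainZE basisE eqxx mulr1.
rewrite big1 ?addr0 // => S' nS; rewrite chainZE basisE eq_sym (negPf nS).
exact: mulr0.
Qed.

Lemma lin_lift_is_linear l F : linear (lin_lift l F).
Proof.
move=> k u v; rewrite /lin_lift scaler_sumr -big_split /=.
by apply: eq_bigr => S _; rewrite chainDE chainZE scalerDl -scalerA.
Qed.

HB.instance Definition _ l F :=
  GRing.isLinear.Build R chain chain _ (lin_lift l F) (lin_lift_is_linear l F).

Lemma lin_lift_gen l F S : listing S (l S) -> lin_lift l F (gen S (l S)) = F S.
Proof.
case/gen_listing=> p _ [_ E]; rewrite {1}E linearZ /= /lin_lift (bigD1 S) //= big1.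
  rewrite addr0 E chainZE !basisE eqxx scale1r mulr1 scalerA -expr2 sqrr_sign.
  by rewrite scale1r.
by move=> S' /negPf nS; rewrite basisE nS scale0r.
Qed.

(** Universal property of the module generated by the [gen S x], for [x]
    listing [negs S], subject to the relations of [gen_map]. *)
Lemma chain_universal (M : lmodType R) (f : estate -> seq (crossing D) -> M) :
    (forall S (p : {perm crossing D}) x, listing S x -> perm_on (negs S) p ->
       f S (map p x) = (-1) ^+ p *: f S x) ->
  exists2 h : {linear chain -> M},
    forall S x, listing S x -> h (gen S x) = f S x
    & forall h' : {linear chain -> M},
        (forall S x, listing S x -> h' (gen S x) = f S x) -> h' =1 h.
Proof.
move=> Hf; pose h (z : chain) := \sum_S (z S : R) *: f S (enum (negs S)).
have h_lin : linear h.
  move=> k u v; rewrite /h scaler_sumr -big_split /=.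
  by apply: eq_bigr => S _; rewrite chainDE chainZE scalerDl -scalerA.
pose hM := GRing.isLinear.Build R chain M _ h h_lin.
pose hL : {linear chain -> M} := HB.pack h hM.
have hb S : hL (basis S) = f S (enum (negs S)).
  rewrite /= /h (bigD1 S) //= basisE eqxx scale1r big1 ?addr0 // => S' /negPf nS.
  by rewrite basisE nS scale0r.
have Le S : listing S (enum (negs S)) by apply: perm_refl.
exists hL => [S x /gen_listing[p Hp [-> ->]]|h' Hh' z].
  by rewrite linearZ_LR hb Hf.
rewrite (chain_decomp z) !linear_sum; apply: eq_bigr => S _.
by rewrite !linearZ_LR hb -gen_enum Hh'.
Qed.

(** The homological grading: [2 i(S) = w(D) - sigma(S)]. *)
Definition sigma (S : estate) : int :=
  \sum_(x : crossing D) (if mark S x then 1 else -1).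

Definition in_degree (i : int) (z : chain) : Prop :=
  forall S, z S != 0 -> 2 * i = writhe - sigma S.

Definition Vmod : lmodType R := {ffun bool -> R^o}.
Definition V2mod : lmodType R := {ffun bool * bool -> R^o}.
Definition lab (p : bool) : Vmod := [ffun r => (r == p)%:R].
Definition lab2 (p q : bool) : V2mod := [ffun r => (r == (p, q))%:R].

Definition mulV (p q : bool) : Vmod :=
  match p, q with
  | true, true => s *: lab true + t *: lab false
  | false, false => lab false
  | _, _ => lab true
  end.

Definition comulV (p : bool) : V2mod :=
  if p then lab2 true true + t *: lab2 false false
  else lab2 true false + lab2 false true - s *: lab2 false false.

(** The coefficient of [S'] in the combination of enhanced states obtained from
    [S] by a saddle which replaces the arcs through [u] and [v] by two other
    arcs, again one through [u] and one through [v]; outside these circles, the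
    signs are unchanged.  [I] is a set of points at which signs are not
    compared, since the move may put them on a different circle.  In a planar
    diagram, a saddle always merges two circles or splits one. *)
Definition saddle (I : {set point}) (u v : point) (S S' : estate) : R :=
  if [forall w, [&& w \notin I, ~~ same_circle (mark S) u w
                  & ~~ same_circle (mark S) v w] ==> (sgn S' w == sgn S w)]
  then if same_circle (mark S) u v then comulV (sgn S u) (sgn S' u, sgn S' v)
       else mulV (sgn S u) (sgn S v) (sgn S' u)
  else 0.

Definition make_neg (m : {ffun crossing D -> bool}) (a : crossing D) :
  {ffun crossing D -> bool} := [ffun x => (x != a) && m x].

Definition delta_gen (S : estate) (x : seq (crossing D)) : chain :=
  \sum_(a | mark S a) \sum_(S' | mark S' == make_neg (mark S) a)
    saddle set0 (inl (a, 0)) (inl (a, 2)) S S' *: gen S' (rcons x a).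

Definition delta : chain -> chain :=
  lin_lift (fun S => enum (negs S)) (fun S => delta_gen S (enum (negs S))).

HB.instance Definition _ := GRing.Linear.on delta.

Lemma deltaE S x : listing S x -> delta (gen S x) = delta_gen S x.
Proof.
case/gen_listing=> p Hp [-> ->]; rewrite linearZ_LR -gen_enum.
rewrite /= /delta lin_lift_gen; last exact: perm_refl.
rewrite /delta_gen scaler_sumr; apply: eq_bigr => a Sa.
rewrite scaler_sumr; apply: eq_bigr => S' /eqP mS'.
have -> : rcons (map p (enum (negs S))) a = map p (rcons (enum (negs S)) a).
  by rewrite map_rcons (out_perm Hp) // inE Sa.
rewrite gen_map ?scalerA ?[_ * (-1) ^+ _]mulrC //.
apply: subset_trans Hp _; apply/subsetP => y; rewrite !inE mS' ffunE => /negPf ->.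
by rewrite andbF.
Qed.

End Complex.

(** The four corners of a crossing whose lower strand joins NE and SW; [f] tells
    that this strand is oriented from SW to NE. *)
Section Corners.
Variables (D : link_diagram) (x : crossing D) (f : bool).
Definition ne : dart D := (x, if f then 2 else 0).
Definition nw : dart D := (x, ne.2 + 1).
Definition sw : dart D := (x, ne.2 + 2).
Definition se : dart D := (x, ne.2 + 3).
End Corners.

(** In each of the crossings of the disk, the upper strand joins NW and SE and
    the lower one NE and SW.  The corners which are not glued inside the disk
    are the points T1, T2, T3, B1, B2, B3 of its boundary. *)
Record r3_site (D : link_diagram) := R3Site {
  ca : crossing D; cb : crossing D; cc : crossing D;
  fa : bool; fb : bool; fc : bool;
  r3_uniq : uniq [:: ca; cb; cc];
  glue_ca : glue (sw cc fc) = nw ca fa;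
  glue_cb : glue (se cc fc) = nw cb fb;
  glue_ab : glue (ne ca fa) = sw cb fb
}.

Section R3.
Variables (R : comNzRingType) (s t : R).
Variables (D : link_diagram) (L : r3_site D).

Local Notation a := (ca L).
Local Notation b := (cb L).
Local Notation c := (cc L).

Definition T1 : point D := inl (nw c (fc L)).
Definition T2 : point D := inl (ne c (fc L)).
Definition T3 : point D := inl (ne b (fb L)).
Definition B1 : point D := inl (sw a (fa L)).
Definition B2 : point D := inl (se a (fa L)).
Definition B3 : point D := inl (se b (fb L)).

Definition inside : {set point D} :=
  [set inl (sw c (fc L)); inl (se c (fc L)); inl (nw a (fa L));
       inl (ne a (fa L)); inl (nw b (fb L)); inl (sw b (fb L))].

(** The point [sw c] lies on the small circle of the states [E_{+-+}]. *)
Definition small (S : estate D) : bool := sgn S (inl (sw c (fc L))).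

(** [is_E al be ga S] : [S] is one of the [E_{al be ga}]. *)
Definition is_E (al be ga : bool) (S : estate D) : bool :=
  [&& mark S a == al, mark S b == be & mark S c == ga].

Definition same_out_marks (S S' : estate D) : bool :=
  [forall x, (x \notin [:: a; b; c]) ==> (mark S' x == mark S x)].

(** [S'] has the same signs as [S] on all arcs and circles other than the
    small circle. *)
Definition same_out (S S' : estate D) : bool :=
  same_out_marks S S' && [forall u, (u \notin inside) ==> (sgn S' u == sgn S u)].

(** Negative crossings outside and inside the disk; [gen S (x ++ din S)] is
    [E(..) (x) [x]], [[xa]], [[xb]], [[xab]], ... according to the markers. *)
Definition out_negs (S : estate D) : seq (crossing D) :=
  [seq y <- enum (negs S) | y \notin [:: a; b; c]].
Definition din (S : estate D) : seq (crossing D) :=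
  [seq y <- [:: a; b; c] | ~~ mark S y].

Definition r3_lift (F : estate D -> seq (crossing D) -> chain D R) :
    chain D R -> chain D R :=
  lin_lift (fun S => out_negs S ++ din S) (fun S => F S (out_negs S)).

Section OutsidePermutations.
Variables (S : estate D) (p : {perm crossing D}).
Hypothesis Hp : perm_on (negs S :\: [set a; b; c]) p.

Lemma out_perm_fix y : y \in [:: a; b; c] -> p y = y.
Proof.
move=> Hy; apply: (out_perm Hp); apply: contraL Hy; rewrite !inE => /andP[+ _].
by rewrite orbA.
Qed.

Lemma gen_map_out S' y z : same_out_marks S S' -> {subset z <= [:: a; b; c]} ->
  gen R S' (map p y ++ z) = (-1) ^+ p *: gen R S' (y ++ z).
Proof.
move=> /forallP mS' Hz; have -> : map p y ++ z = map p (y ++ z).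
  rewrite map_cat -[z in LHS]map_id; congr (_ ++ _); apply/eq_in_map => w wz.
  by rewrite out_perm_fix ?Hz.
apply: gen_map; apply: subset_trans Hp _; apply/subsetP => w; rewrite !inE -orbA.
by case/andP=> wabc; have := mS' w; rewrite !inE wabc => /eqP ->.
Qed.

End OutsidePermutations.

Lemma din_sub S : {subset din S <= [:: a; b; c]}.
Proof. by move=> y; rewrite mem_filter => /andP[]. Qed.

Lemma r3_liftE F S x :
    (forall (p : {perm crossing D}) y, perm_on (negs S :\: [set a; b; c]) p ->
       F S (map p y) = (-1) ^+ p *: F S y) ->
  listing S (x ++ din S) -> r3_lift F (gen R S (x ++ din S)) = F S x.
Proof.
have Hl : listing S (out_negs S ++ din S).
  apply: uniq_perm; rewrite ?enum_uniq //.
    rewrite cat_uniq; apply/and3P; split.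
    - by rewrite filter_uniq ?enum_uniq.
    - by apply/hasPn => y /din_sub yabc; rewrite /= mem_filter yabc.
    - by rewrite filter_uniq ?r3_uniq.
  move=> y; rewrite mem_cat /out_negs /din 2!mem_filter mem_enum.
  rewrite [y \in negs S]inE; case: (mark S y); rewrite ?andbF //= andbT.
  exact: orNb.
move=> HF Hx.
have Ex : perm_eq x (out_negs S).
  by rewrite -(perm_cat2r (din S)); apply: perm_trans Hx _; rewrite perm_sym.
have [|p + Ep] := perm_eq_map _ Ex; first by rewrite filter_uniq ?enum_uniq.
have -> : [set y in out_negs S] = negs S :\: [set a; b; c].
  by apply/setP => y; rewrite !inE mem_filter mem_enum !inE orbA.
move=> Hp; have mS : same_out_marks S S by apply/forallP => y; rewrite eqxx implybT.
rewrite Ep HF // (gen_map_out Hp _ mS (@din_sub S)) /r3_lift linearZ_LR /=.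
by rewrite lin_lift_gen.
Qed.

(** The saddle {T3B3, B1B2} <-> {B1T3, B2B3}, in both directions: T3 and B2 lie
    on the two arcs both before and after. *)
Definition saddle_ab : estate D -> estate D -> R := saddle s t inside T3 B2.

(** The saddle {T3B3, T1T2} -> {T2T3, T1B3}, T3 and T1 playing that role. *)
Definition saddle_bc : estate D -> estate D -> R := saddle s t inside T3 T1.

(** [E_{-++}(p,q,r) |-> E_{-++}(p:q,q:p,~r) (x) [xa]] and back. *)
Definition to_Ea (S : estate D) (x : seq (crossing D)) : chain D R :=
  \sum_(S' | is_E false true true S' && same_out_marks S S')
    saddle_ab S S' *: gen R S' (rcons x a).

Definition to_Eb (S : estate D) (x : seq (crossing D)) : chain D R :=
  \sum_(S' | [&& is_E true false true S', ~~ small S' & same_out_marks S S'])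
    saddle_ab S S' *: gen R S' (rcons x b).

(** The saddle from [E_{+-+}] to [E_{-++}] followed by its reverse. *)
Definition to_Ebb (S : estate D) (x : seq (crossing D)) : chain D R :=
  \sum_(S' | is_E false true true S' && same_out_marks S S')
    saddle_ab S S' *: to_Eb S' x.

Definition to_Ec (S : estate D) (x : seq (crossing D)) : chain D R :=
  \sum_(S' | is_E true true false S' && same_out_marks S S')
    saddle_bc S S' *: gen R S' (rcons x c).

Definition rho3_gen (S : estate D) (x : seq (crossing D)) : chain D R :=
  if is_E false true true S then gen R S (rcons x a) + to_Eb S x
  else if ~~ mark S c then gen R S (x ++ din S)
  else if is_E true false true S && small S then
    - to_Ea S x - to_Ebb S x - to_Ec S x
  else if is_E false false true S then
    \sum_(S' | is_E true false false S' && same_out S S') gen R S' (x ++ [:: b; c])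
  else 0.

Definition in_rho3 : chain D R -> chain D R := r3_lift rho3_gen.

HB.instance Definition _ := GRing.Linear.on in_rho3.

Lemma in_rho3E S x : listing S (x ++ din S) ->
  in_rho3 (gen R S (x ++ din S)) = rho3_gen S x.
Proof.
apply: r3_liftE => p y Hp.
have mS : same_out_marks S S by apply/forallP => w; rewrite eqxx implybT.
have Eb S' : same_out_marks S S' -> to_Eb S' (map p y) = (-1) ^+ p *: to_Eb S' y.
  move=> mS'; rewrite scaler_sumr; apply: eq_bigr => S2 /and3P[_ _ mS2].
  rewrite -!cats1 (gen_map_out Hp) ?scalerA 1?[_ * (-1) ^+ _]mulrC //.
    apply/forallP => w; apply/implyP => wabc.
    have /implyP/(_ wabc)/eqP <- := forallP mS' w.
    exact: (implyP (forallP mS2 w)).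
  by move=> w; rewrite !inE => /eqP ->; rewrite eqxx orbT.
rewrite /rho3_gen; case: ifP => _.
  rewrite scalerDr Eb // -!cats1 (gen_map_out Hp) //.
  by move=> w; rewrite !inE => ->.
case: ifP => _; first exact: (gen_map_out Hp) (@din_sub S).
case: ifP => _.
  rewrite !scalerBr scalerN; congr (- _ - _ - _).
  - rewrite scaler_sumr; apply: eq_bigr => S' /andP[_ mS'].
    rewrite -!cats1 (gen_map_out Hp) ?scalerA 1?[_ * (-1) ^+ _]mulrC //.
    by move=> w; rewrite !inE => ->.
  - rewrite scaler_sumr; apply: eq_bigr => S' /andP[_ mS'].
    by rewrite Eb // !scalerA mulrC.
  - rewrite scaler_sumr; apply: eq_bigr => S' /andP[_ mS'].
    rewrite -!cats1 (gen_map_out Hp) ?scalerA 1?[_ * (-1) ^+ _]mulrC //.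
    by move=> w; rewrite !inE => ->; rewrite !orbT.
case: ifP => _; last by rewrite scaler0.
rewrite scaler_sumr; apply: eq_bigr => S' /and3P[_ mS' _].
by apply: (gen_map_out Hp) => // w; rewrite !inE => ->; rewrite orbT.
Qed.

(** Each sum has exactly one term, as has the last one in [rho3_gen]. *)
Definition h3_gen (S : estate D) (x : seq (crossing D)) : chain D R :=
  if is_E false false true S then
    - \sum_(S' | [&& is_E true false true S', ~~ small S' & same_out S S'])
        gen R S' (rcons x b)
  else if is_E true false true S && small S then
    \sum_(S' | is_E true true true S' && same_out S S') gen R S' x
  else 0.

Definition h3 : chain D R -> chain D R := r3_lift h3_gen.

HB.instance Definition _ := GRing.Linear.on h3.

Lemma h3E S x : listing S (x ++ din S) -> h3 (gen R S (x ++ din S)) = h3_gen S x.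
Proof.
apply: r3_liftE => p y Hp; rewrite /h3_gen; case: ifP => _.
  rewrite scalerN scaler_sumr; congr (- _).
  apply: eq_bigr => S' /and4P[_ _ mS' _]; rewrite -!cats1 (gen_map_out Hp) //.
  by move=> w; rewrite !inE => ->; rewrite orbT.
case: ifP => _; last by rewrite scaler0.
rewrite scaler_sumr; apply: eq_bigr => S' /and3P[_ mS' _].
by rewrite -(cats0 (map _ _)) -[in RHS](cats0 y); apply: (gen_map_out Hp).
Qed.

End R3.

(* Main.v *)
(** By linearity it suffices to compare both sides on a generator, according to
    its markers at [a], [b], [c].  In the states [E_{+++}], [E_{--+}],
    [E_{+-+}] and [E_{+--}] the disk joins its boundary points in the same way,
    so that signs can be transported between them, and saddles at crossings
    outside the disk cancel up to the sign of a transposition.  Inside the disk,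
    [-] is the unit of the product and the component of the coproduct with [+]
    on the small circle is the identity, which takes care of every case but
    [E^+_{+-+}].  There, the terms of [rho3] with a single saddle come from
    [delta] on [E_{+++}], and the double saddle is the identity
    [D_-(p) (x) q + p (x) m(+:q) = (p:q):(q:p) (x) (q:p):(p:q)], where [D_-(p)]
    is the component of the coproduct with [-] on the small circle.

    Here one must know that a saddle merges two circles or splits one, never
    sending one circle to one circle.  This is where planarity enters: by Euler's
    formula and a rank count over F_2, the faces of the diagram can be
    two-coloured, hence the darts alternately oriented, whatever the smoothing;
    a change of marker then multiplies the permutation which has the circles as
    cycles by a transposition. *)
Require Import Defs.
From HB Require Import structures.
From mathcomp Require Import all_boot all_order all_algebra all_fingroup.
From mathcomp Require Import mxabelem zify ring.

Set Implicit Arguments.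
Unset Strict Implicit.
Unset Printing Implicit Defensive.

Import GRing.Theory.
Local Open Scope ring_scope.

(** * Checkerboard colouring of a planar diagram *)

(** How the arcs of the disk are joined outside it is not known: a saddle inside may merge or split
    according to [D], and no list of circles can be written down. Everything is therefore expressed
    through points. A state is a sign on points, two points lie on one circle iff every state with
    these markers gives them the same sign, and a saddle is a coefficient read at two points. For
    two configurations of the disk that join the boundary points alike, agreement of signs off the
    six inner ends determines the partner of a state, up to the sign of the small circle; this makes
    the reindexings of sums bijective. The minus sign of [h3] on [E_{--+}] comes from the order of
    crossings: the saddle at [a] turns a sequence [[xb]] into [[xba]], which is minus [[xab]]. *)

Lemma card_invariant (T : finType) (e : rel T) : connect_sym e ->
  #|[set f : {ffun T -> 'F_2} | [forall x, forall y, e x y ==> (f x == f y)]]|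
  = (2 ^ n_comp e predT)%N.
Proof.
move=> sym_e; pose rt x : {x | x \in fingraph.roots e} := exist _
  (fingraph.root e x) (roots_root sym_e x).
(* An invariant function is a free choice of values at the roots, one per component; [ext] spreads
   such a choice. *)
pose ext (g : {ffun {x | x \in fingraph.roots e} -> 'F_2}) := [ffun x => g (rt x)].
have -> : n_comp e predT = #|{: {x | x \in fingraph.roots e}}|.
  by rewrite card_sig; apply: eq_card => x; rewrite !inE andbT.
have -> : (2 ^ #|{: {x | x \in fingraph.roots e}}| = #|ext @: setT|)%N.
  rewrite card_imset; first by rewrite cardsT card_ffun card_Fp.
  move=> g g' /ffunP E; apply/ffunP => -[x xr]; have := E x; rewrite !ffunE.
  by have -> : rt x = exist _ x xr by apply: val_inj; apply/eqP.
apply: eq_card => f; rewrite inE; apply/forallP/imsetP => [Hf|[g _ ->] x].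
  exists [ffun z => f (val z)] => //; apply/ffunP => x; rewrite !ffunE /=.
  have /connectP[p + ->] := connect_root e x.
  elim: p x => //= y p IH x /andP[exy /IH <-].
  by have /forallP/(_ y)/implyP/(_ exy)/eqP := Hf x.
apply/forallP => y; apply/implyP => exy; rewrite !ffunE; apply/eqP; congr (g _).
by apply: val_inj; apply/eqP; rewrite /= root_connect ?connect1.
Qed.

(** * Functions on a finite set as row vectors, composition as a matrix *)

Section Pullback.
Variable F : fieldType.

Definition vec (T : finType) (f : T -> F) : 'rV[F]_#|T| := \row_i f (enum_val i).

(** The entry is 1 at [(h b, b)]: acting on rows from the right this is composition with [h], and
    the transpose is summation over the fibres of [h]. *)
Definition pull (A B : finType) (h : B -> A) : 'M[F]_(#|A|, #|B|) :=
  \matrix_(i, j) (enum_val i == h (enum_val j))%:R.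

Lemma vecK (T : finType) (u : 'rV[F]_#|T|) : vec (fun x => u 0 (enum_rank x)) = u.
Proof. by apply/rowP => i; rewrite mxE enum_valK. Qed.

Lemma eq_vec (T : finType) (f g : T -> F) : vec f = vec g <-> f =1 g.
Proof.
split=> [/rowP E x|E]; last by apply/rowP => i; rewrite !mxE.
by have := E (enum_rank x); rewrite !mxE enum_rankK.
Qed.

Lemma vecB (T : finType) (f g : T -> F) : vec f - vec g = vec (fun x => f x - g x).
Proof. by apply/rowP => i; rewrite !mxE. Qed.

Lemma vec_pull (A B : finType) (h : B -> A) f : vec f *m pull h = vec (f \o h).
Proof.
apply/rowP => j; rewrite !mxE (bigD1 (enum_rank (h (enum_val j)))) //= !mxE.
rewrite enum_rankK eqxx mulr1 big1 ?addr0 // => i ni.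
rewrite !mxE (_ : _ == _ = false) ?mulr0 //; apply: contraNF ni => /eqP <-.
by rewrite enum_valK.
Qed.

Lemma vec_sub_pull (T : finType) (h : T -> T) f :
  vec f *m (1%:M - pull h) = vec (fun x => f x - f (h x)).
Proof. by rewrite mulmxBr mulmx1 vec_pull vecB. Qed.

Lemma vec_sub_pull_eq0 (T : finType) (h : T -> T) f :
  (vec f *m (1%:M - pull h) == 0) = [forall x, f x == f (h x)].
Proof.
have -> : 0 = vec (fun _ : T => 0) :> 'rV[F]_#|T| by apply/rowP => i; rewrite !mxE.
rewrite vec_sub_pull; apply/eqP/forallP => [/eq_vec E x|E].
  by rewrite -subr_eq0 E.
by apply/eq_vec => x; apply/eqP; rewrite subr_eq0.
Qed.

Lemma pull_inv (T : finType) (g : T -> T) : involutive g -> (pull g)^T = pull g.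
Proof. by move=> gK; apply/matrixP => i j; rewrite !mxE eq_sym inv_eq. Qed.

Lemma vec_pull_tr (A B : finType) (h : B -> A) f :
  vec f *m (pull h)^T = vec (fun a => \sum_(b | h b == a) f b).
Proof.
apply/rowP => j; rewrite !mxE [RHS]big_mkcond /= (reindex _ (onW_bij _
  (enum_val_bij B))) /=.
by apply: eq_bigr => i _; rewrite !mxE eq_sym; case: ifP; rewrite ?mulr1 ?mulr0.
Qed.

End Pullback.

(** Over F_2 a row space of rank r has 2 ^ r elements, so counting the invariant functions gives the
    rank. *)
Lemma mxrank_invariant (T : finType) (e : rel T) n (A : 'M['F_2]_(n, #|T|)) :
    connect_sym e ->
    (forall f, (vec f <= A)%MS = [forall x, forall y, e x y ==> (f x == f y)]) ->
  \rank A = n_comp e predT.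
Proof.
move=> sym_e HA; apply/eqP; rewrite -(eqn_exp2l _ _ (ltnSn 1)) -card_invariant //.
rewrite -[X in (X ^ \rank _)%N](card_Fp (p := 2)) // -card_rowg.
pose f2v (f : {ffun T -> 'F_2}) := vec f.
rewrite -(card_imset (f := f2v)); last by move=> f g /eq_vec/ffunP.
apply/eqP; apply: eq_card => u; rewrite inE; apply/idP/imsetP => [uA|[f + ->]].
  exists [ffun x => u 0 (enum_rank x)]; last first.
    by rewrite /f2v -[LHS]vecK; apply/eq_vec => x; rewrite ffunE.
  rewrite inE; move: uA; rewrite -[in X in X -> _](vecK u) HA.
  by apply: etrans; apply: eq_forallb => x; apply: eq_forallb => y; rewrite !ffunE.
by rewrite inE HA.
Qed.

(** * Mod 2 homology of a planar code *)

Section Checkerboard.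
Variables (V : finType) (g : V * 'Z_4 -> V * 'Z_4) (out : V * 'Z_4 -> bool).
Hypothesis gK : involutive g.
Hypothesis out_g : forall d, out (g d) = ~~ out d.
Hypothesis euler :
  fcard (face_step g) predT = (#|V| + 2 * n_comp (dart_adj g) predT)%N.

Local Notation T := (V * 'Z_4)%type.

Lemma rot_inj : injective (@rot_dart V).
Proof. by move=> [x i] [y j] /eqP; rewrite xpair_eqE /= (inj_eq (addIr _)) =>
  /andP[/eqP -> /eqP ->]. Qed.

Lemma rot_dart4 (d : T) : iter 4 (@rot_dart V) d = d.
Proof.
by case: d => x i; rewrite /rot_dart /= -!addrA; congr (_, _);
  rewrite [X in _ + X](_ : _ = 0) ?addr0 //; apply: val_inj.
Qed.

Lemma face_step_inj : injective (face_step g).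
Proof. by move=> d d' /rot_inj/(inv_inj gK). Qed.

Lemma dart_adj_sym : connect_sym (dart_adj g).
Proof.
have adj d d' : dart_adj g d d' -> connect (dart_adj g) d' d.
  case/orP => /eqP ->; last by apply: connect1; rewrite /dart_adj /= gK eqxx orbT.
  have step k d0 : connect (dart_adj g) d0 (ssrnat.iter k (@rot_dart V) d0).
    elim: k => // k IH; apply: connect_trans IH _; apply: connect1.
    by rewrite /dart_adj /= eqxx.
  by have := step 3 (rot_dart d); rewrite -iterSr rot_dart4.
move=> d d'; apply/idP/idP => /connectP[p + ->].
  elim: p d => //= d1 p IH d /andP[/adj dd1 /IH H]; exact: connect_trans dd1.
elim: p d' => //= d1 p IH d' /andP[/adj dd1 /IH H]; exact: connect_trans dd1.
Qed.

Lemma fcard_g : fcard g predT = (2 * #|V|)%N.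
Proof.
have : (fcard g predT * 2 = #|{: T}|)%N.
  rewrite -[RHS](eq_card (A := predT)) //; apply: fcard_order_set => //.
    exact: inv_inj gK.
  apply/subsetP => d _; rewrite inE; apply/eqP.
  have gd : g d != d by apply/eqP => E; have := out_g d; rewrite E; case: (out d).
  apply: (@order_cycle _ _ [:: d; g d]); last by rewrite inE eqxx.
    by rewrite /= gK !eqxx.
  by rewrite /= inE eq_sym gd.
rewrite card_prod card_ord /= -[4%N]/(2 * 2)%N mulnA => /eqP.
by rewrite eqn_pmul2r // mulnC => /eqP.
Qed.

(** Over F_2, [Tm] adds up the two values on each edge, so its image consists of functions on edges.
    [K] spans the functions constant on faces. [A] pulls functions on crossings back to darts, and
    its transpose sums over the four ends of a crossing. *)
Let Tm : 'M['F_2]_#|{: T}| := 1%:M - pull _ g.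
Let K := kermx (1%:M - pull 'F_2 (face_step g)).
Let A : 'M['F_2]_(#|V|, #|{: T}|) := pull _ (fun d : T => d.1).

Lemma adj_inv (f : T -> 'F_2) :
  [forall x, forall y, dart_adj g x y ==> (f x == f y)]
  = [forall x, f x == f (rot_dart x)] && [forall x, f x == f (g x)].
Proof.
apply/forallP/andP => [Hf|[/forallP Hr /forallP Hg] x].
  by split; apply/forallP => x; have /forallP H := Hf x;
    apply: (implyP (H _)); rewrite /dart_adj /= eqxx ?orbT.
by apply/forallP => y; apply/implyP => /orP[] /eqP ->.
Qed.

Lemma frel_inv (h : T -> T) (f : T -> 'F_2) :
  [forall x, forall y, frel h x y ==> (f x == f y)] = [forall x, f x == f (h x)].
Proof.
apply: eq_forallb => x; apply/forallP/idP => [/(_ (h x))|H y].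
  by rewrite /= eqxx.
by apply/implyP => /eqP <-.
Qed.

Lemma sub_K f : (vec f <= K)%MS = [forall x, f x == f (face_step g x)].
Proof. by rewrite sub_kermx vec_sub_pull_eq0. Qed.

Lemma sub_kerTm f : (vec f <= kermx Tm)%MS = [forall x, f x == f (g x)].
Proof. by rewrite sub_kermx vec_sub_pull_eq0. Qed.

Lemma rank_K : \rank K = fcard (face_step g) predT.
Proof.
apply: mxrank_invariant => [|f]; first exact: fconnect_sym face_step_inj.
by rewrite sub_K frel_inv.
Qed.

Lemma rank_Tm : \rank Tm = (2 * #|V|)%N.
Proof.
have : \rank (kermx Tm) = (2 * #|V|)%N.
  rewrite -fcard_g; apply: mxrank_invariant => [|f].
    exact: fconnect_sym (inv_inj gK).
  by rewrite sub_kerTm frel_inv.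
have cT : #|{: T}| = (4 * #|V|)%N by rewrite card_prod card_ord mulnC.
rewrite mxrank_ker => E; have := rank_leq_row Tm; lia.
Qed.

(** A function constant on faces and on edges is constant under [rot_dart], hence on components:
    with F faces and C components, the rank drops from F to F - C. *)
Lemma rank_KTm : (\rank (K *m Tm) + n_comp (dart_adj g) predT = \rank K)%N.
Proof.
rewrite -(mxrank_mul_ker K Tm); congr (_ + _)%N; symmetry.
apply: mxrank_invariant => [|f]; first exact: dart_adj_sym.
rewrite sub_capmx [X in X && _]sub_K sub_kerTm adj_inv.
apply: andb_id2r => /forallP Hg; apply/forallP/forallP => H x.
  by have := H (g x); rewrite /face_step gK -(eqP (Hg x)).
by rewrite (eqP (Hg x)); apply: H.
Qed.

Lemma rank_A : \rank A = #|V|.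
Proof.
apply/eqP; apply/row_freeP; exists (pull _ (fun x => (x, 0))).
apply/matrixP => i j; rewrite !mxE (bigD1 (enum_rank (enum_val j, 0))) //= !mxE.
rewrite enum_rankK /= eqxx mulr1 big1 => [|k nk].
  by rewrite addr0 (inj_eq enum_val_inj).
rewrite !mxE (_ : (enum_val k == _) = false) ?mulr0 //.
by apply: contraNF nk => /eqP <-; rewrite enum_valK.
Qed.

(** [Tm] is symmetric because [g] is an involution, so the transpose is the coboundary of functions
    on crossings; it kills those constant on components, and its rank is V - C. *)
Lemma rank_TmA : (\rank (Tm *m A^T) + n_comp (dart_adj g) predT = #|V|)%N.
Proof.
have TmT : Tm^T = Tm by rewrite /Tm linearB /= trmx1 pull_inv.
rewrite -mxrank_tr trmx_mul trmxK TmT -[RHS]rank_A -(mxrank_mul_ker A Tm).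
congr (_ + _)%N; symmetry; apply: mxrank_invariant => [|f].
  exact: dart_adj_sym.
rewrite sub_capmx sub_kerTm adj_inv; congr (_ && _).
apply/idP/forallP => [/submxP[u E] x|H].
  have /eq_vec Ef : vec f = vec ((fun y => u 0 (enum_rank y)) \o (fun d : T => d.1)).
    by rewrite -[RHS]vec_pull vecK.
  by rewrite !Ef /=.
suff -> : vec f = vec (fun x => f (x, 0)) *m A by apply: submxMl.
rewrite vec_pull; apply/eq_vec => -[x i] /=.
rewrite -(natr_Zp i); elim: (val i) => [|k IH] //.
by rewrite -IH -natr1; apply/esym/eqP/(H (x, k%:R)).
Qed.

(** A mod 2 cycle of edges bounds a set of faces: the first homology of a union of spheres vanishes.
    That boundaries are cycles is checked at each crossing; equality holds because both sides have
    rank V + C. On the left this is F - C, with F = V + 2C by Euler's formula, on the right 2V - (V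
    - C). *)
Lemma im_Tm : (K *m Tm :=: Tm :&: kermx A^T)%MS.
Proof.
apply/eqmxP; rewrite -(mxrank_leqif_eq _).
  have := rank_KTm; rewrite rank_K euler => rKT.
  rewrite -(eqn_add2r (n_comp (dart_adj g) predT)) rKT.
  rewrite -(eqn_add2l (\rank (Tm *m A^T))) [eqbRHS]addnA mxrank_mul_ker rank_Tm.
  have := rank_TmA; lia.
rewrite sub_capmx submxMl sub_kermx -mulmxA.
apply/eqP/row_matrixP => i; rewrite row_mul row0.
have : row i K *m (1%:M - pull _ (face_step g)) == 0.
  by rewrite -sub_kermx row_sub.
rewrite -(vecK (row i K)) vec_sub_pull_eq0 => /forallP.
set f := (fun d => _) => Hf; rewrite mulmxA vec_sub_pull vec_pull_tr.
apply/rowP => j; rewrite !mxE; set x := enum_val j; rewrite sumrB; apply/eqP;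
  rewrite subr_eq0.
(* A function [f] on faces satisfies [f (g d) = f (rot_dart d)], and [rot_dart] permutes the ends of
   a crossing. *)
rewrite [eqbLHS](reindex_inj rot_inj); apply/eqP; apply: eq_big => // d _.
by have /eqP/esym := Hf (g d); rewrite /face_step gK.
Qed.

(** Each crossing has four ends, so the sum of all edges is a mod 2 cycle and bounds: some function
    on faces changes its value across every edge. Since [rot_dart d] lies on the face of [g d], it
    also alternates around each crossing. *)
Lemma checkerboard : exists eps : T -> bool,
  (forall d, eps (rot_dart d) = ~~ eps d) /\ (forall d, eps (g d) = ~~ eps d).
Proof.
have F2 (x : 'F_2) : (x == 0) || (x == 1) by case: x => [[|[|]]].
have : (vec (fun _ : T => 1) <= K *m Tm)%MS.
  rewrite im_Tm sub_capmx sub_kermx; apply/andP; split.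
    (* The orientation of the diagram gives a preimage of 1: exactly one dart of each edge is
       outgoing. *)
    suff -> : vec (fun=> 1) = vec (fun d => (out d)%:R) *m Tm by apply: submxMl.
    rewrite vec_sub_pull; apply/eq_vec => d; rewrite out_g.
    by case: (out d); rewrite ?subr0 ?sub0r //; apply: val_inj.
  rewrite vec_pull_tr; apply/eqP/rowP => j; rewrite !mxE.
  rewrite (eq_bigl (fun d => (d.1 == enum_val j) && true)); last by move=> d; rewrite andbT.
  rewrite -(pair_big (pred1 (enum_val j)) predT (fun _ _ => 1)) /= big_pred1_eq.
  by rewrite sumr_const card_ord; apply: val_inj.
case/submxP => u; rewrite mulmxA; set v := u *m K => E.
pose f d := v 0 (enum_rank d).
have /forallP Hf : [forall x, f x == f (face_step g x)].
  by rewrite -sub_K vecK submxMl.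
have /eq_vec Hg : vec (fun _ : T => 1) = vec (fun x => f x - f (g x)).
  by rewrite -vec_sub_pull vecK.
have {}Hg d : (f (g d) == 1) = ~~ (f d == 1).
  by have := Hg d; case/orP: (F2 (f d)) => /eqP ->; case/orP: (F2 (f (g d))) => /eqP -> //.
exists (fun d => f d == 1); split=> d //.
by rewrite -Hg (eqP (Hf (g d))) /face_step gK.
Qed.

End Checkerboard.

(** * State circles *)

Section Circles.
Variable D : link_diagram.
Implicit Types (m : {ffun crossing D -> bool}) (d : dart D) (u v : point D).

Lemma smoothK m : involutive (smooth m).
Proof.
case=> x i; rewrite /smooth /=; congr (_, _).
by case: (m x); case: i => [[|[|[|[|]]]] Hi] //=; apply: val_inj.
Qed.

Lemma arc_adj_sym m : symmetric (arc_adj m).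
Proof.
move=> [d|i] [d'|j] //=.
by rewrite eq_sym (inv_eq (@glueK D)) [X in _ || X]eq_sym (inv_eq (smoothK m)).
Qed.

Lemma same_circle_sym m u v : same_circle m u v = same_circle m v u.
Proof. exact: sym_connect_sym (arc_adj_sym m) u v. Qed.

(** A loop without crossings is adjacent to nothing, so invariance has to be checked on darts
    only. *)
Lemma same_circle_ind m (A : pred (point D)) :
    (forall d, A (inl (glue d)) = A (inl d)) ->
    (forall d, A (inl (smooth m d)) = A (inl d)) ->
  forall u v, same_circle m u v -> A u = A v.
Proof.
move=> Hg Hs u v /connectP[p + ->]; elim: p u => //= v1 p IH u /andP[+ /IH <-].
by case: u v1 => [d|i] [d'|j] //= /orP[] /eqP ->.
Qed.

Lemma same_circle_refl m u : same_circle m u u.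
Proof. exact: connect0. Qed.

Lemma same_circle_glue m d : same_circle m (inl d) (inl (glue d)).
Proof. by apply: connect1; rewrite /= eqxx. Qed.

Lemma same_circle_smooth m d : same_circle m (inl d) (inl (smooth m d)).
Proof. by apply: connect1; rewrite /= eqxx orbT. Qed.

(** The negative pairing 12, 30 is the half turn of the crossing followed by the positive pairing
    01, 23. On the two ends of one colour the half turn is a transposition. *)
Lemma smooth_make_neg m a d : m a ->
  smooth (make_neg m a) d = smooth m (if d.1 == a then (d.1, d.2 + 2) else d).
Proof.
case: d => x i ma; rewrite /smooth ffunE /=; case: eqP => //= -> /=; congr (_, _).
by rewrite ma; case: i => [[|[|[|[|]]]] Hi] //=; apply: val_inj.
Qed.

(* The circles, oriented so that [eps] is constant along them, are the cycles
   of a permutation of half of the darts. *)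
Lemma same_circle_make_neg m a : m a ->
  same_circle (make_neg m a) (inl (a, 0)) (inl (a, 2))
  = ~~ same_circle m (inl (a, 0)) (inl (a, 2)).
Proof.
move=> ma; have [eps [eps_rot eps_glue]] :=
  checkerboard (@glueK D) (@glue_outgoing D) (@planar D).
have eps_smooth m' d : eps (smooth m' d) = ~~ eps d.
  rewrite /smooth; case: ifP => _; first by rewrite -eps_rot.
  have {3}-> : d = rot_dart (d.1, d.2 - 1).
    by rewrite /rot_dart /= subrK -surjective_pairing.
  by rewrite eps_rot negbK.
pose u : dart D := (a, 0); pose v : dart D := (a, 2).
have eps_v : eps v = eps u.
  rewrite -[RHS]negbK -!eps_rot /rot_dart /=; congr (eps (_, _)).
  exact: val_inj.
(* Smoothing and gluing each change the colour, so their composite preserves it; the darts of the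
   other colour are fixed, to get a permutation of all darts. *)
pose f m' d := if eps d == eps u then glue (smooth m' d) else d.
have f_inj m' : injective (f m').
  rewrite /f => d d'; case: ifP => Ed; case: ifP => Ed'.
  - by move/(inv_inj (@glueK D))/(inv_inj (smoothK m')).
  - by move=> E; rewrite -E eps_glue eps_smooth negbK Ed in Ed'.
  - by move=> E; rewrite E eps_glue eps_smooth negbK Ed' in Ed.
  - by [].
pose s m' := perm (f_inj m').
have sE m' d : eps d = eps u -> s m' d = glue (smooth m' d).
  by move=> Ed; rewrite permE /f Ed eqxx.
have circP m' : same_circle m' (inl u) (inl v) = (u \in porbit (s m') v).
  have orb1 d : (s m' d \in porbit (s m') v) = (d \in porbit (s m') v).
    by rewrite -!eq_porbit_mem -[in LHS](expg1 (s m')) porbit_perm.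
  apply/idP/idP => [/same_circle_ind H|].
    (* A dart of the other colour is represented by the one glued to it. *)
    pose A (w : point D) := if w is inl d then
      if eps d == eps u then d \in porbit (s m') v else glue d \in porbit (s m') v
      else false.
    have := H A; rewrite /A eqxx eps_v eqxx porbit_id => -> // d.
    - rewrite eps_glue glueK; case: ifP => Ed; case: ifP => Ed' //.
        by case: (eps d) (eps u) Ed Ed' => [] [].
      by case: (eps d) (eps u) Ed Ed' => [] [].
    - rewrite eps_smooth; case: ifP => Ed; case: ifP => Ed' //.
      + by case: (eps d) (eps u) Ed Ed' => [] [].
      + rewrite -[in glue d](smoothK m' d) -sE; last first.
          by rewrite eps_smooth; apply/eqP.
        by rewrite orb1.
      + by rewrite -sE ?(eqP Ed') // orb1.
      + by case: (eps d) (eps u) Ed Ed' => [] [].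
  case/porbitP => k ->; rewrite same_circle_sym; elim: k => [|k IH].
    by rewrite perm1; apply: connect0.
  rewrite expgSr permM; apply: connect_trans IH _; set d := (_ v).
  rewrite permE /f; case: ifP => _; last exact: connect0.
  exact: connect_trans (same_circle_smooth m' d) (same_circle_glue m' _).
rewrite !circP.
have -> : s (make_neg m a) = (tperm u v * s m)%g.
  apply/permP => d; rewrite permM; case: tpermP => [->|->|/eqP du /eqP dv].
  - rewrite !sE // smooth_make_neg // eqxx /=; congr (glue (smooth m (_, _))).
    exact: val_inj.
  - rewrite !sE // smooth_make_neg // eqxx /=; congr (glue (smooth m (_, _))).
    exact: val_inj.
  - rewrite !permE /f; case: ifP => // Ed; rewrite smooth_make_neg //.
    case: ifP => // /eqP da; move: Ed du dv; rewrite /u /v.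
    case: d da => _ i /= ->; rewrite !xpair_eqE eqxx /=.
    (* At [a] only the ends 0 and 2 have the colour of [u]. *)
    have E13 : eps (a, 1) = ~~ eps u.
      by rewrite -eps_rot /rot_dart /=; congr (eps (_, _)); apply: val_inj.
    have E3 : eps (a, 3) = ~~ eps u.
      by rewrite -eps_v -eps_rot /rot_dart /=; congr (eps (_, _)); apply: val_inj.
    have E1' (j : 'Z_4) : j = 1 \/ j = 3 -> (eps (a, j) == eps u) = false.
      by case=> ->; rewrite ?E13 ?E3; case: (eps u).
    case: i => [[|[|[|[|]]]] Hi] //= Ed _ _.
      by rewrite E1' // in Ed; left; apply: val_inj.
    by rewrite E1' // in Ed; right; apply: val_inj.
(* Multiplying by the transposition adds a cycle if [u] and [v] share one, and removes one
   otherwise. Counting there and back shows that [u] and [v] share a cycle for exactly one of the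
   two markers. *)
have := porbits_mul_tperm (s m) u v.
have := porbits_mul_tperm (tperm u v * s m) u v.
have -> : u != v by rewrite xpair_eqE eqxx.
rewrite /= mulgA tperm2 mul1g.
move: #|_| #|_| => n1 n2.
by case: (u \in porbit (s m) v); case: (u \in porbit (_ * _) v) => //=; lia.
Qed.

Lemma is_estateP m (f : {ffun point D -> bool}) :
  reflect ((forall d, f (inl (glue d)) = f (inl d)) /\
           (forall d, f (inl (smooth m d)) = f (inl d)))
          (is_estate (m, f)).
Proof.
apply: (iffP forallP) => [H|[Hg Hs] u].
  have {}H u v : same_circle m u v -> f u = f v.
    by move=> uv; apply/eqP; have /forallP/(_ v)/implyP := H u; apply.
  by split=> d; apply/esym/H; [apply: same_circle_glue|apply: same_circle_smooth].
apply/forallP => v; apply/implyP => /(same_circle_ind Hg Hs) ->.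
exact: eqxx.
Qed.

Lemma sgn_glue (S : estate D) d : sgn S (inl (glue d)) = sgn S (inl d).
Proof.
by case: S => [[m f] Sf]; have /is_estateP[+ _] := Sf; apply.
Qed.

Lemma sgn_smooth (S : estate D) d : sgn S (inl (smooth (mark S) d)) = sgn S (inl d).
Proof.
by case: S => [[m f] Sf]; have /is_estateP[_ +] := Sf; apply.
Qed.

Lemma sgn_circle (S : estate D) u v : same_circle (mark S) u v -> sgn S u = sgn S v.
Proof. exact: (same_circle_ind (sgn_glue S) (sgn_smooth S)). Qed.

Lemma estate_ex m (f : point D -> bool) :
    (forall d, f (inl (glue d)) = f (inl d)) ->
    (forall d, f (inl (smooth m d)) = f (inl d)) ->
  exists2 S : estate D, mark S = m & sgn S =1 f.
Proof.
move=> Hg Hs; have Sf : is_estate (m, [ffun u => f u]).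
  by apply/is_estateP; split=> d; rewrite !ffunE.
by exists (Estate Sf) => // u; rewrite /sgn ffunE.
Qed.

Lemma estate_eq (S S' : estate D) : mark S = mark S' -> sgn S =1 sgn S' -> S = S'.
Proof.
case: S S' => [[m f] Sf] [[m' f'] Sf'] /= Em Ef; apply: val_inj => /=.
by congr (_, _) => //; apply/ffunP => u; apply: Ef.
Qed.

(** The indicator of the circle of [u] is a sign assignment, so signs separate circles. How arcs are
    joined is thus computed on the signs of all states with given markers, then read as a fact on
    circles. *)
Lemma same_circleP m u v :
  reflect (forall S : estate D, mark S = m -> sgn S u = sgn S v) (same_circle m u v).
Proof.
apply: (iffP idP) => [uv S mS|H]; first by apply: sgn_circle; rewrite mS.
have [d|d|S mS ES] := @estate_ex m (same_circle m u).
- exact/esym/(same_connect_r (sym_connect_sym (arc_adj_sym m)))/same_circle_glue.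
- exact/esym/(same_connect_r (sym_connect_sym (arc_adj_sym m)))/same_circle_smooth.
- by rewrite -ES -H // ES; apply: connect0.
Qed.

End Circles.

(** * Smoothing and signs at the four corners of a crossing *)

Section CornerTheory.
Variables (D : link_diagram) (x : crossing D) (f : bool).

Lemma neE : ne x f = (x, if f then 2 else 0).
Proof. by []. Qed.
Lemma nwE : nw x f = (x, if f then 3 else 1).
Proof. by rewrite /nw /ne /=; congr (_, _); case: f; apply: val_inj. Qed.
Lemma swE : sw x f = (x, if f then 0 else 2).
Proof. by rewrite /sw /ne /=; congr (_, _); case: f; apply: val_inj. Qed.
Lemma seE : se x f = (x, if f then 1 else 3).
Proof. by rewrite /se /ne /=; congr (_, _); case: f; apply: val_inj. Qed.

Definition cornersE := (neE, nwE, swE, seE).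

Lemma corner_ind (P : dart D -> Prop) :
  P (ne x f) -> P (nw x f) -> P (sw x f) -> P (se x f) ->
  forall d, d.1 = x -> P d.
Proof.
rewrite !cornersE => P0 P1 P2 P3 [_ i] /= ->.
have : i \in [:: 0; 1; 2; 3] by case: i => [[|[|[|[|]]]] Hi].
by move: P0 P1 P2 P3; rewrite !inE; case: f => P0 P1 P2 P3 /or4P[] /eqP ->.
Qed.

Lemma smooth_ne m : smooth m (ne x f) = if m x then nw x f else se x f.
Proof.
rewrite !cornersE /smooth /=; case: (m x); case: f => /=; congr (_, _); exact: val_inj.
Qed.
Lemma smooth_nw m : smooth m (nw x f) = if m x then ne x f else sw x f.
Proof.
rewrite !cornersE /smooth /=; case: (m x); case: f => /=; congr (_, _); exact: val_inj.
Qed.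
Lemma smooth_sw m : smooth m (sw x f) = if m x then se x f else nw x f.
Proof.
rewrite !cornersE /smooth /=; case: (m x); case: f => /=; congr (_, _); exact: val_inj.
Qed.
Lemma smooth_se m : smooth m (se x f) = if m x then sw x f else ne x f.
Proof.
rewrite !cornersE /smooth /=; case: (m x); case: f => /=; congr (_, _); exact: val_inj.
Qed.

Definition smooth_corner := (smooth_ne, smooth_nw, smooth_sw, smooth_se).

Variable S : estate D.
Local Notation sg d := (sgn S (inl d)).

Lemma sgn_pos : mark S x -> (sg (nw x f) = sg (ne x f)) * (sg (se x f) = sg (sw x f)).
Proof.
move=> Sx; have := sgn_smooth S (ne x f); have := sgn_smooth S (sw x f).
by rewrite smooth_ne smooth_sw Sx.
Qed.

Lemma sgn_neg : mark S x = false ->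
  (sg (se x f) = sg (ne x f)) * (sg (sw x f) = sg (nw x f)).
Proof.
move=> Sx; have := sgn_smooth S (ne x f); have := sgn_smooth S (nw x f).
by rewrite smooth_ne smooth_nw Sx.
Qed.

End CornerTheory.

(** * Saddles *)

Section SaddleTheory.
Variables (R : comNzRingType) (s t : R) (D : link_diagram).
Implicit Types (S : estate D) (u v w : point D) (I : {set point D}).

Local Notation sc S := (same_circle (mark S)).
Local Notation saddle := (saddle s t).

Definition comul_coef (p e f : bool) : R :=
  if p then (if e && f then 1 else if ~~ e && ~~ f then t else 0)
  else (if e && f then 0 else if e || f then 1 else - s).

Definition mul_coef (p q e : bool) : R :=
  if p && q then (if e then s else t) else (e == p || q)%:R.

Lemma comul_coefE p e f : comulV s t p (e, f) = comul_coef p e f.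
Proof.
case: p; case: e; case: f; rewrite !ffunE /= /GRing.scale /= ?oppr0 ?mulr0 ?mulr1;
  by rewrite ?subr0 ?addr0 ?add0r ?sub0r ?oppr0.
Qed.

Lemma mul_coefE p q e : mulV s t p q e = mul_coef p q e.
Proof.
case: p; case: q; case: e; rewrite !ffunE /= ?ffunE /GRing.scale /= ?mulr0 ?mulr1;
  by rewrite ?addr0 ?add0r.
Qed.

Lemma comul_coefC p e f : comul_coef p e f = comul_coef p f e.
Proof. by rewrite /comul_coef; case: e; case: f. Qed.

Lemma mul_coefC p q e : mul_coef p q e = mul_coef q p e.
Proof. by rewrite /mul_coef andbC orbC. Qed.

Definition agree I u v S S' : bool :=
  [forall w, [&& w \notin I, ~~ sc S u w & ~~ sc S v w] ==> (sgn S' w == sgn S w)].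

Lemma agreeP I u v S S' :
  reflect (forall w, w \notin I -> ~~ sc S u w -> ~~ sc S v w -> sgn S' w = sgn S w)
          (agree I u v S S').
Proof.
apply: (iffP forallP) => [H w wI uw vw|H w].
  by have := H w; rewrite wI uw vw => /eqP.
by apply/implyP => /and3P[wI uw vw]; rewrite H.
Qed.

Lemma saddleE I u v S S' : saddle I u v S S' =
  (agree I u v S S')%:R * (if sc S u v then comul_coef (sgn S u) (sgn S' u) (sgn S' v)
                           else mul_coef (sgn S u) (sgn S v) (sgn S' u)).
Proof.
rewrite /Defs.saddle -/(agree I u v S S'); case: agree; last by rewrite mul0r.
by rewrite mul1r comul_coefE mul_coefE.
Qed.

Lemma circle_eql m u v : same_circle m u v -> same_circle m u =1 same_circle m v.
Proof. exact: (same_connect (sym_connect_sym (arc_adj_sym m))). Qed.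

Lemma circle_eqr m u v w : same_circle m u v -> same_circle m w u = same_circle m w v.
Proof. by move/circle_eql => E; rewrite same_circle_sym E same_circle_sym. Qed.

Lemma agreeC I u v S S' : agree I u v S S' = agree I v u S S'.
Proof. by apply/agreeP/agreeP => H w wI uw vw; apply: H. Qed.

(** A split is symmetric by cocommutativity, but a merge reads the new sign at the first point only;
    the hypothesis makes the two readings equal. *)
Lemma saddleC I u v S S' : (~~ sc S u v -> sgn S' u = sgn S' v) ->
  saddle I u v S S' = saddle I v u S S'.
Proof.
rewrite !saddleE agreeC (same_circle_sym _ v u) mul_coefC.
case: ifP => [uv _|_ ->//]; by rewrite (sgn_circle uv) comul_coefC.
Qed.

Lemma circle_corner x f S S' : mark S x -> mark S' = make_neg (mark S) x ->
  sc S' (inl (ne x f)) (inl (sw x f)) = ~~ sc S (inl (ne x f)) (inl (sw x f)).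
Proof.
move=> Sx mS'; have := same_circle_make_neg Sx; rewrite -mS' neE swE.
by case: f; rewrite // !(same_circle_sym _ (inl (x, 2))).
Qed.

(** Whether the end 0 is NE or SW depends on the direction of the lower strand. Exchanging the two
    ends is legitimate because after a merge they lie on one circle. *)
Lemma saddle_corner x f S S' :
    mark S x -> mark S' = make_neg (mark S) x ->
  saddle set0 (inl (x, 0)) (inl (x, 2)) S S'
    = saddle set0 (inl (ne x f)) (inl (sw x f)) S S'.
Proof.
move=> Sx mS'; have := circle_corner f Sx mS'; rewrite neE swE.
by case: f => // H; apply: saddleC; rewrite same_circle_sym -H => /sgn_circle.
Qed.

Lemma saddle_congr I u v S S' I1 u1 v1 S1 S1' :
    agree I u v S S' = agree I1 u1 v1 S1 S1' ->
    sc S u v = sc S1 u1 v1 -> sgn S u = sgn S1 u1 -> sgn S v = sgn S1 v1 ->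
    sgn S' u = sgn S1' u1 -> sgn S' v = sgn S1' v1 ->
  saddle I u v S S' = saddle I1 u1 v1 S1 S1'.
Proof. by rewrite !saddleE => -> -> -> -> -> ->. Qed.

(** For one surgery described by two pairs of reference points which share arcs before it, but lie
    on opposite arcs after it. *)
Lemma saddle_congr_swap I u v S S' I1 u1 v1 S1 S1' :
    agree I u v S S' = agree I1 u1 v1 S1 S1' ->
    sc S u v = sc S1 u1 v1 -> sgn S u = sgn S1 u1 -> sgn S v = sgn S1 v1 ->
    sgn S' u = sgn S1' v1 -> sgn S' v = sgn S1' u1 ->
    (~~ sc S u v -> sgn S' u = sgn S' v) ->
  saddle I u v S S' = saddle I1 u1 v1 S1 S1'.
Proof.
rewrite !saddleE => -> -> -> -> <- <-; case: ifP => _ H; first by rewrite comul_coefC.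
by rewrite H.
Qed.

End SaddleTheory.

(** * Signs of the generators under reordering of crossings *)

Section Generators.
Variables (R : comNzRingType) (D : link_diagram).
Implicit Types (S : estate D) (x l : seq (crossing D)).
Local Notation gen := (gen R).

Lemma gen_nlisting S l : ~~ listing S l -> gen S l = 0.
Proof.
rewrite /Defs.gen; case: pickP => // p /andP[Hp /eqP ->] /negP[].
apply: uniq_perm; rewrite ?enum_uniq ?map_inj_uniq ?enum_uniq //; first exact: perm_inj.
move=> y; rewrite mem_enum -[y in LHS](permKV p) mem_map; last exact: perm_inj.
by rewrite mem_enum perm_closed // perm_onV.
Qed.

Lemma gen_supp S l S' : S' != S -> gen S l S' = 0.
Proof.
move=> nS; rewrite /Defs.gen; case: pickP => [p _|_]; last by rewrite ffunE.
by rewrite chainZE basisE (negPf nS) mulr0.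
Qed.

Lemma gen_swap S x u v l : gen S (x ++ u :: v :: l) = - gen S (x ++ v :: u :: l).
Proof.
have E : perm_eq (x ++ u :: v :: l) (x ++ v :: u :: l).
  by rewrite perm_cat2l; apply/permPl/(perm_catCA [:: u] [:: v]).
have [H|nH] := boolP (listing S (x ++ v :: u :: l)); last first.
  by rewrite !gen_nlisting ?oppr0 // /listing (permPl E).
have U : uniq (x ++ v :: u :: l) by rewrite (perm_uniq H) enum_uniq.
have mem w : w \in x ++ v :: u :: l -> w \in negs S by rewrite (perm_mem H) mem_enum.
have -> : x ++ u :: v :: l = map (tperm u v) (x ++ v :: u :: l).
  rewrite map_cat /= tpermL tpermR; move: U.
  rewrite cat_uniq /= !inE !negb_or => /and3P[_ /and3P[vx ux _] /and3P[/andP[_ vl] ul _]].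
  have fix_ z : v \notin z -> u \notin z -> map (tperm u v) z = z.
    move=> vz uz; rewrite -[RHS]map_id; apply/eq_in_map => w wz; rewrite tpermD //.
      by apply: contraNneq uz => ->.
    by apply: contraNneq vz => ->.
  by rewrite !fix_.
rewrite gen_map; last first.
  apply/subsetP => w; rewrite inE; case: tpermP => [->|->|]; rewrite ?eqxx // => _;
  by rewrite mem // mem_cat !inE eqxx ?orbT.
rewrite odd_tperm; have -> : u != v.
  by move: U; rewrite cat_uniq /= !inE => /and3P[_ _ /andP[/norP[+ _] _]]; rewrite eq_sym.
by rewrite expr1 scaleN1r.
Qed.

Lemma gen_rotate S x z y :
  gen S (rcons (x ++ z) y) = (-1) ^+ size z *: gen S (rcons x y ++ z).
Proof.
elim: z x => [|w z IH] x; first by rewrite !cats0 scale1r.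
rewrite -cat_rcons IH /= exprS -scalerA !cat_rcons gen_swap.
by rewrite !scalerN scaleN1r.
Qed.

Lemma listing_rcons S S' y l : listing S l -> mark S y ->
  mark S' = make_neg (mark S) y -> listing S' (rcons l y).
Proof.
move=> H Sy mS'; have U : uniq l by rewrite (perm_uniq H) enum_uniq.
have mem w : (w \in l) = (w \in negs S) by rewrite (perm_mem H) mem_enum.
apply: uniq_perm; rewrite ?enum_uniq ?rcons_uniq ?mem ?U ?andbT ?inE ?Sy //.
move=> w; rewrite mem_rcons inE mem mem_enum !inE mS' ffunE.
by case: eqP.
Qed.

Lemma listing_perm S l l' : perm_eq l l' -> listing S l = listing S l'.
Proof. by rewrite /listing => /permPl ->. Qed.

End Generators.

(** * States at the site of a third Reidemeister move *)

Section Site.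
Variables (D : link_diagram) (L : r3_site D).
Implicit Types (S : estate D) (u v w : point D).

Local Notation a := (ca L).
Local Notation b := (cb L).
Local Notation c := (cc L).
Local Notation ins := (inside L).
Local Notation T1 := (T1 L).
Local Notation T2 := (T2 L).
Local Notation T3 := (T3 L).
Local Notation B1 := (B1 L).
Local Notation B2 := (B2 L).
Local Notation B3 := (B3 L).

Lemma site_neq : [/\ (a == b) = false, (a == c) = false & (b == c) = false].
Proof.
have := r3_uniq L; rewrite /= !inE negb_or andbT => /andP[/andP[]].
by move=> /negPf -> /negPf -> /negPf ->.
Qed.

Lemma in_inside d : (inl d \in ins) =
  (d \in [:: sw c (fc L); se c (fc L); nw a (fa L); ne a (fa L);
             nw b (fb L); sw b (fb L)]).
Proof. by rewrite !inE -!orbA. Qed.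

Lemma inside_corner :
  ((inl (ne a (fa L)) \in ins) * (inl (nw a (fa L)) \in ins)
  * (inl (nw b (fb L)) \in ins) * (inl (sw b (fb L)) \in ins)
  * (inl (sw c (fc L)) \in ins) * (inl (se c (fc L)) \in ins))
  * ((inl (sw a (fa L)) \in ins = false) * (inl (se a (fa L)) \in ins = false)
  * (inl (ne b (fb L)) \in ins = false) * (inl (se b (fb L)) \in ins = false)
  * (inl (nw c (fc L)) \in ins = false) * (inl (ne c (fc L)) \in ins = false)).
Proof.
have [ab ac bc] := site_neq.
have E := (ab, ac, bc, eq_sym b a, eq_sym c a, eq_sym c b).
by do ![split]; rewrite in_inside !inE ?eqxx ?orbT // !cornersE !xpair_eqE ?E /=
  ?eqxx; case: (fa L); case: (fb L); case: (fc L).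
Qed.

Lemma inside_terminal :
  (T1 \in ins = false) * (T2 \in ins = false) * (T3 \in ins = false)
  * (B1 \in ins = false) * (B2 \in ins = false) * (B3 \in ins = false).
Proof. by rewrite !inside_corner. Qed.

Lemma inr_inside i : (inr i \in ins) = false.
Proof. by rewrite !inE. Qed.

Lemma inside_other d : d.1 \notin [:: a; b; c] -> (inl d \in ins) = false.
Proof.
apply: contraNF; rewrite in_inside !inE.
by do ![case/orP]; move=> /eqP ->; rewrite eqxx ?orbT.
Qed.

Lemma glue_inside d : (inl (glue d) \in ins) = (inl d \in ins).
Proof.
suff H d' : inl d' \in ins -> inl (glue d') \in ins.
  by apply/idP/idP => /H; rewrite ?glueK.
have Ec := esym (glue_ca L); have Eb := esym (glue_cb L); have Ea := esym (glue_ab L).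
rewrite in_inside => H; move: H; rewrite 6!in_cons in_nil orbF.
do ![case/orP]; move=> /eqP ->;
  by rewrite ?Ec ?Eb ?Ea ?glueK ?(glue_ca, glue_cb, glue_ab) inside_corner.
Qed.

Lemma sgn_glue_site S : [/\ sgn S (inl (nw a (fa L))) = sgn S (inl (sw c (fc L))),
  sgn S (inl (nw b (fb L))) = sgn S (inl (se c (fc L))) &
  sgn S (inl (sw b (fb L))) = sgn S (inl (ne a (fa L)))].
Proof. by rewrite -glue_ca -glue_cb -glue_ab !sgn_glue. Qed.

(** The majority of [al], [~~ be] and [ga]: true exactly for [+++], [--+], [+-+] and [+--]. *)
Definition xmarks (al be ga : bool) := al && (ga || ~~ be) || ga && ~~ be.

(** In each of the four configurations all six inner ends lie together: on [T1T2] in [+--], on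
    [B1B2] in [--+], on [T3B3] in [+++], and on the small circle, of sign [o], in [+-+]. *)
Definition inside_sign al be ga (o : bool) S : bool :=
  if ~~ ga then sgn S T1 else if ~~ al then sgn S B1
  else if be then sgn S T3 else o.

(* In the states [E_{+++}], [E_{--+}], [E_{+-+}] and [E_{+--}] the boundary
   points are joined in the same way. *)
Definition xstate S := xmarks (mark S a) (mark S b) (mark S c).

Lemma xstate_is_E al be ga S : is_E L al be ga S -> xmarks al be ga -> xstate S.
Proof. by rewrite /xstate => /and3P[/eqP -> /eqP -> /eqP ->]. Qed.

Lemma sgn_xstate S : xstate S ->
  [/\ sgn S T2 = sgn S T1, sgn S B3 = sgn S T3, sgn S B2 = sgn S B1 &
      forall u, u \in ins ->
        sgn S u = inside_sign (mark S a) (mark S b) (mark S c) (small L S) S].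
Proof.
have [Ga Gb Gab] := sgn_glue_site S.
have all_ins z : sgn S (inl (sw c (fc L))) = z -> sgn S (inl (se c (fc L))) = z ->
    sgn S (inl (ne a (fa L))) = z -> forall u, u \in ins -> sgn S u = z.
  move=> E1 E2 E3 [d|i]; rewrite ?inr_inside // in_inside !inE.
  by do ![case/orP]; move=> /eqP ->; rewrite ?Ga ?Gb ?Gab ?E1 ?E2 ?E3.
(* [sg] hides the types of the points from [congruence]. *)
have [sg sgE] : exists sg : dart D -> bool, forall d, sgn S (inl d) = sg d.
  by exists (fun d => sgn S (inl d)).
have pos x f : mark S x -> sg (nw x f) = sg (ne x f) /\ sg (se x f) = sg (sw x f).
  by move/(sgn_pos f); rewrite !sgE => -[].
have neg x f : mark S x = false -> sg (se x f) = sg (ne x f) /\ sg (sw x f) = sg (nw x f).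
  by move/(sgn_neg f); rewrite !sgE => -[].
rewrite /xstate /xmarks /inside_sign /small /Defs.T1 /Defs.T2 /Defs.T3.
rewrite /Defs.B1 /Defs.B2 /Defs.B3 !sgE in Ga Gb Gab *.
case Ma: (mark S a); case Mb: (mark S b); case Mc: (mark S c) => //= _.
all: try have [A1 A2] := pos _ (fa L) Ma.
all: try have [A1 A2] := neg _ (fa L) Ma.
all: try have [E1 E2] := pos _ (fb L) Mb.
all: try have [E1 E2] := neg _ (fb L) Mb.
all: try have [C1 C2] := pos _ (fc L) Mc.
all: try have [C1 C2] := neg _ (fc L) Mc.
all: by split; last apply: all_ins; rewrite ?sgE; congruence.
Qed.

Lemma same_out_sgn S S' u : same_out L S S' -> u \notin ins -> sgn S' u = sgn S u.
Proof. by case/andP=> _ /forallP/(_ u)/implyP H /H/eqP. Qed.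

Lemma same_out_mark S S' x : same_out_marks L S S' -> x \notin [:: a; b; c] ->
  mark S' x = mark S x.
Proof. by move/forallP/(_ x)/implyP => H /H/eqP. Qed.

Lemma same_out_marksP S S' :
  reflect (forall x, x \notin [:: a; b; c] -> mark S' x = mark S x)
    (same_out_marks L S S').
Proof.
apply: (iffP idP) => [H x|H]; first exact: same_out_mark.
by apply/forallP => x; apply/implyP => /H ->.
Qed.

Lemma same_out_sym S S' : same_out L S S' = same_out L S' S.
Proof.
rewrite /same_out; congr (_ && _); apply: eq_forallb => x; by rewrite eq_sym.
Qed.

Lemma same_out_marks_sym S S' : same_out_marks L S S' = same_out_marks L S' S.
Proof. by apply: eq_forallb => x; rewrite eq_sym. Qed.

Lemma same_out_marks_trans S1 S2 S3 : same_out_marks L S1 S2 ->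
  same_out_marks L S2 S3 -> same_out_marks L S1 S3.
Proof.
move=> H1 H2; apply/same_out_marksP => x Hx.
by rewrite (same_out_mark H2 Hx) (same_out_mark H1 Hx).
Qed.

Lemma same_out_trans S1 S2 S3 : same_out L S1 S2 -> same_out L S2 S3 ->
  same_out L S1 S3.
Proof.
move=> S12 S23; have [[m12 _] [m23 _]] := (andP S12, andP S23).
rewrite /same_out (same_out_marks_trans m12 m23); apply/forallP => u.
by apply/implyP => uN; rewrite (same_out_sgn S23) // (same_out_sgn S12).
Qed.

Lemma same_outW S S' : same_out L S S' -> same_out_marks L S S'.
Proof. by case/andP. Qed.

Lemma eq_mark al be ga S S' : is_E L al be ga S -> is_E L al be ga S' ->
  same_out_marks L S S' -> mark S = mark S'.
Proof.
move=> /and3P[/eqP Sa /eqP Sb /eqP Sc] /and3P[/eqP Sa' /eqP Sb' /eqP Sc'] H.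
apply/ffunP => x; have [|/(same_out_mark H)//] := boolP (x \in [:: a; b; c]).
by rewrite !inE => /or3P[] /eqP ->; congruence.
Qed.

Definition site_marks al be ga (m : {ffun crossing D -> bool}) :
    {ffun crossing D -> bool} :=
  [ffun x => if x == a then al else if x == b then be else if x == c then ga
             else m x].

Lemma site_marksE al be ga m :
  [/\ site_marks al be ga m a = al, site_marks al be ga m b = be,
      site_marks al be ga m c = ga &
      forall x, x \notin [:: a; b; c] -> site_marks al be ga m x = m x].
Proof.
have [ab ac bc] := site_neq.
rewrite !ffunE eqxx (eq_sym b) (eq_sym c) (eq_sym c b) ab ac bc !eqxx; split=> // x.
by rewrite ffunE !inE; do 3!case: (x == _).
Qed.

(** The boundary points being joined alike, the outer signs of [S] stay consistent when the inner
    markers change; the inner ends take the sign of the arc or circle that contains them all. *)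
Lemma fit_ex al be ga o S : xmarks al be ga -> xstate S ->
  exists2 S', is_E L al be ga S' && same_out L S S'
    & forall u, u \in ins -> sgn S' u = inside_sign al be ga o S.
Proof.
move=> X XS; have [ET EB3 EB _] := sgn_xstate XS.
set z := inside_sign _ _ _ _ _.
have [ma mb mc mo] := site_marksE al be ga (mark S).
have [d|d|S' mS' ES'] := @estate_ex D (site_marks al be ga (mark S))
    (fun u => if u \in ins then z else sgn S u).
- by rewrite glue_inside sgn_glue.
- have [di|dN] := boolP (d.1 \in [:: a; b; c]); last first.
    have -> : smooth (site_marks al be ga (mark S)) d = smooth (mark S) d.
      by rewrite /smooth mo.
    by rewrite !inside_other // sgn_smooth.
  pose F u := if u \in ins then z else sgn S u.
  pose P d0 := F (inl (smooth (site_marks al be ga (mark S)) d0)) = F (inl d0).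
  have {di} : [|| d.1 == a, d.1 == b | d.1 == c] by move: di; rewrite !inE.
  case/or3P=> /eqP dx; move: d dx.
  + apply: (@corner_ind D a (fa L) P); rewrite /P /F smooth_corner ma /z;
      by case: al X @z {ma mb mc mo P F} => //; case: be => //; case: ga => // _;
      rewrite !inside_corner.
  + apply: (@corner_ind D b (fb L) P); rewrite /P /F smooth_corner mb /z;
      by case: al X @z {ma mb mc mo P F} => //; case: be => //; case: ga => // _;
      rewrite !inside_corner.
  + apply: (@corner_ind D c (fc L) P); rewrite /P /F smooth_corner mc /z;
      by case: al X @z {ma mb mc mo P F} => //; case: be => //; case: ga => // _;
      rewrite !inside_corner.
- exists S' => [|u ui]; last by rewrite ES' ui.
  rewrite /is_E mS' ma mb mc !eqxx /=; apply/andP; split.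
    by apply/same_out_marksP => x /mo; rewrite mS'.
  by apply/forallP => u; apply/implyP => /negPf uN; rewrite ES' uN.
Qed.

(** Uniqueness to go with [fit_ex]: inner signs are forced by outer ones, except on the small
    circle. *)
Lemma xstate_eq al be ga S S' : is_E L al be ga S -> is_E L al be ga S' ->
    xmarks al be ga -> same_out L S S' ->
    ([&& al, ~~ be & ga] -> small L S = small L S') ->
  S = S'.
Proof.
move=> ES ES' X SS' Hsm; apply: estate_eq.
  exact: eq_mark ES ES' (same_outW SS').
have [_ _ _ I] := sgn_xstate (xstate_is_E ES X).
have [_ _ _ I'] := sgn_xstate (xstate_is_E ES' X).
move=> u; have [ui|/(same_out_sgn SS')//] := boolP (u \in ins).
rewrite I // I' //; move: ES ES' => /and3P[/eqP -> /eqP -> /eqP ->].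
move=> /and3P[/eqP -> /eqP -> /eqP ->].
rewrite /inside_sign !(same_out_sgn SS') ?inside_terminal //.
by case: al be ga Hsm {X} => [] [] [] //= ->.
Qed.

(** A state separating [u] and [v] for one choice of inner markers is carried by [fit_ex] to the
    other, with the same outer signs. *)
Lemma same_circle_xstate S S' u v : xstate S -> xstate S' -> same_out_marks L S S' ->
  u \notin ins -> v \notin ins ->
  same_circle (mark S) u v = same_circle (mark S') u v.
Proof.
have imp S1 S2 : xstate S1 -> xstate S2 -> same_out_marks L S1 S2 ->
    u \notin ins -> v \notin ins ->
    same_circle (mark S1) u v -> same_circle (mark S2) u v.
  move=> X1 X2 S12 ui vi uv; apply/same_circleP => S2' M2.
  have X2' : xstate S2' by rewrite /xstate M2.
  have [S1' /andP[E1' SS'] _] := fit_ex false X1 X2'.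
  rewrite -!(same_out_sgn SS') //; apply: sgn_circle.
  rewrite -(eq_mark (al := mark S1 a) (be := mark S1 b) (ga := mark S1 c) (S := S1)) //.
    by rewrite /is_E !eqxx.
  apply: same_out_marks_trans S12 _; apply: same_out_marks_trans (same_outW SS').
  by apply/same_out_marksP => x _; rewrite M2.
move=> XS XS' SS' ui vi; apply/idP/idP; apply: imp => //.
by rewrite same_out_marks_sym.
Qed.

Lemma circle_xstate S : xstate S ->
  [/\ same_circle (mark S) T2 T1, same_circle (mark S) B3 T3
    & same_circle (mark S) B2 B1].
Proof.
move=> X; have H S' : mark S' = mark S -> xstate S' by rewrite /xstate => ->.
by split; apply/same_circleP => S' /H/sgn_xstate[].
Qed.

Lemma circle_inside S : xstate S -> is_E L true false true S = false ->
  forall u, u \in ins -> same_circle (mark S) u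
    (if ~~ mark S c then T1 else if ~~ mark S a then B1 else T3).
Proof.
move=> X nE u ui; apply/same_circleP => S' mS'.
have X' : xstate S' by rewrite /xstate mS'.
have [_ _ _ ->//] := sgn_xstate X'; move: X nE; rewrite /xstate /is_E /inside_sign !mS'.
by case: (mark S a); case: (mark S b); case: (mark S c).
Qed.

(** The sign of the small circle is free: [fit_ex] with the sign opposite to that of an outer point
    gives a state separating the two. *)
Lemma circle_small S u : is_E L true false true S ->
  same_circle (mark S) (inl (sw c (fc L))) u = (u \in ins).
Proof.
move=> ES; have X := xstate_is_E ES isT; apply/same_circleP/idP => [H|ui S' mS'].
  apply: contraT => uN; have [S' /andP[ES' SS'] IS'] := fit_ex (~~ sgn S u)
    (isT : xmarks true false true) X.
  have := H S' (eq_mark ES' ES _); rewrite IS' ?inside_corner // (same_out_sgn SS') //.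
  rewrite same_out_marks_sym => /(_ (same_outW SS')).
  by rewrite /inside_sign /=; case: (sgn S u).
have X' : xstate S' by rewrite /xstate mS'.
have [_ _ _ I] := sgn_xstate X'; rewrite !I ?inside_corner //.
Qed.

End Site.

(** * The homotopy *)

Section Homotopy.
Variables (R : comNzRingType) (s t : R) (D : link_diagram) (L : r3_site D).
Implicit Types (S : estate D) (u v w : point D).

Local Notation a := (ca L).
Local Notation b := (cb L).
Local Notation c := (cc L).
Local Notation ins := (inside L).
Local Notation T1 := (T1 L).
Local Notation T2 := (T2 L).
Local Notation T3 := (T3 L).
Local Notation B1 := (B1 L).
Local Notation B2 := (B2 L).
Local Notation B3 := (B3 L).
Local Notation is_E := (is_E L).
Local Notation gen := (gen R).
Local Notation small := (small L).
Local Notation sc S := (same_circle (mark S)).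
Local Notation saddle := (saddle s t).
Local Notation dsaddle x := (saddle set0 (inl (x, 0)) (inl (x, 2))).

Lemma site_neqs : ((a == b) = false) * ((a == c) = false) * ((b == c) = false)
  * ((b == a) = false) * ((c == a) = false) * ((c == b) = false).
Proof. by have [ab ac bc] := site_neq L; do ![split]; rewrite // eq_sym. Qed.

(** * Changes of one marker and their saddle coefficients *)

Lemma mark_make_neg_a be ga S S' : is_E true be ga S ->
  (mark S' == make_neg (mark S) a) = is_E false be ga S' && same_out_marks L S S'.
Proof.
move=> /and3P[/eqP Sa /eqP Sb /eqP Sc].
apply/eqP/andP => [mS'|[/and3P[/eqP Sa' /eqP Sb' /eqP Sc'] H]].
  rewrite /is_E mS' !ffunE Sb Sc !site_neqs !eqxx; split=> //.
  by apply/same_out_marksP => x xN; rewrite mS' ffunE; case: eqP xN => // ->;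
    rewrite inE eqxx.
apply/ffunP => x; rewrite ffunE; have [|xN] := boolP (x \in [:: a; b; c]).
  by rewrite !inE => /or3P[] /eqP ->; rewrite ?eqxx ?site_neqs /=; congruence.
by rewrite (same_out_mark H) //; case: eqP xN => // ->; rewrite inE eqxx.
Qed.

Lemma mark_make_neg_b al ga S S' : is_E al true ga S ->
  (mark S' == make_neg (mark S) b) = is_E al false ga S' && same_out_marks L S S'.
Proof.
move=> /and3P[/eqP Sa /eqP Sb /eqP Sc].
apply/eqP/andP => [mS'|[/and3P[/eqP Sa' /eqP Sb' /eqP Sc'] H]].
  rewrite /is_E mS' !ffunE Sa Sc !site_neqs !eqxx; split=> //.
  by apply/same_out_marksP => x xN; rewrite mS' ffunE; case: eqP xN => // ->;
    rewrite !inE eqxx orbT.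
apply/ffunP => x; rewrite ffunE; have [|xN] := boolP (x \in [:: a; b; c]).
  by rewrite !inE => /or3P[] /eqP ->; rewrite ?eqxx ?site_neqs /=; congruence.
by rewrite (same_out_mark H) //; case: eqP xN => // ->; rewrite !inE eqxx orbT.
Qed.

Lemma mark_make_neg_c al be S S' : is_E al be true S ->
  (mark S' == make_neg (mark S) c) = is_E al be false S' && same_out_marks L S S'.
Proof.
move=> /and3P[/eqP Sa /eqP Sb /eqP Sc].
apply/eqP/andP => [mS'|[/and3P[/eqP Sa' /eqP Sb' /eqP Sc'] H]].
  rewrite /is_E mS' !ffunE Sa Sb !site_neqs !eqxx; split=> //.
  by apply/same_out_marksP => x xN; rewrite mS' ffunE; case: eqP xN => // ->;
    rewrite !inE eqxx !orbT.
apply/ffunP => x; rewrite ffunE; have [|xN] := boolP (x \in [:: a; b; c]).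
  by rewrite !inE => /or3P[] /eqP ->; rewrite ?eqxx ?site_neqs /=; congruence.
by rewrite (same_out_mark H) //; case: eqP xN => // ->; rewrite !inE eqxx !orbT.
Qed.

(** With one point used twice, [agree] allows a change of sign on the circle of [u] only; this is
    the form taken by saddles that create or absorb the small circle. *)
Lemma same_outP S S' u : xstate L S -> same_out_marks L S S' -> xstate L S' ->
    u \notin ins ->
  agree ins u u S S' && (sgn S' u == sgn S u) = same_out L S S'.
Proof.
move=> X m X' uN; apply/andP/idP => [[/agreeP H /eqP Eu]|H].
  rewrite /same_out m; apply/forallP => w; apply/implyP => wN.
  have [uw|nuw] := boolP (sc S u w); last by rewrite H.
  rewrite -(sgn_circle uw) -Eu; apply/eqP/esym/sgn_circle.
  by rewrite -(same_circle_xstate X X').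
split; last by rewrite (same_out_sgn H).
by apply/agreeP => w wN _ _; apply: same_out_sgn H wN.
Qed.

(** In [E_{+++}] both strands at [b] belong to the arc [T3B3], so the saddle splits off the small
    circle, however the arcs are joined outside. *)
Lemma saddle_b S S' : is_E true true true S -> is_E true false true S' ->
    same_out_marks L S S' ->
  dsaddle b S S' = (agree ins T3 T3 S S')%:R * comul_coef s t (sgn S T3)
    (sgn S' T3) (small S').
Proof.
move=> E E' m; have X := xstate_is_E E isT; have X' := xstate_is_E E' isT.
have /and3P[_ /eqP Sb _] := E.
rewrite (saddle_corner s t (fb L) Sb (eqP (etrans (mark_make_neg_b _ E)
  (introT andP (conj E' m))))).
have ci u : u \in ins -> sc S T3 u.
  have /and3P[/eqP Sa _ /eqP Sc] := E.
  move=> ui; rewrite same_circle_sym; have := circle_inside X _ ui.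
  by rewrite Sa Sc; apply; rewrite /is_E Sb /= !andbF.
have [_ _ _ I'] := sgn_xstate X'.
have csw := ci _ (inside_corner L).1.1.1.2.
rewrite saddleE (_ : sc S _ _) // (I' (inl (sw b (fb L)))) ?inside_corner //.
have -> : inside_sign L (mark S' a) (mark S' b) (mark S' c) (small S') S' = small S'.
  by have /and3P[/eqP -> /eqP -> /eqP ->] := E'.
congr ((nat_of_bool _)%:R * _); apply/agreeP/agreeP => H w wI uw _; apply: H => //.
- by rewrite inE.
- by rewrite -(circle_eql csw).
- by apply: contra uw; apply: ci.
Qed.

Lemma sgn_small S u : is_E true false true S -> u \in ins -> sgn S u = small S.
Proof.
move=> E ui; have [_ _ _ ->//] := sgn_xstate (xstate_is_E E isT).
by have /and3P[/eqP -> /eqP -> /eqP ->] := E.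
Qed.

Lemma small_apart S u v : is_E true false true S -> u \in ins ->
  sc S u v = (v \in ins).
Proof.
move=> E ui; rewrite -(circle_small v E); symmetry.
by apply: circle_eql; rewrite circle_small.
Qed.

(** No boundary point lies on the small circle, so here and at [c] the saddle merges it, into [B1B2]
    and [T1T2] respectively. *)
Lemma saddle_a S S' : is_E true false true S -> is_E false false true S' ->
    same_out_marks L S S' ->
  dsaddle a S S' = (agree ins B1 B1 S S')%:R * mul_coef s t (small S) (sgn S B1)
    (sgn S' B1).
Proof.
move=> E E' m; have X := xstate_is_E E isT; have X' := xstate_is_E E' isT.
have /and3P[/eqP Sa _ _] := E.
rewrite (saddle_corner s t (fa L) Sa (eqP (etrans (mark_make_neg_a _ E)
  (introT andP (conj E' m))))).
have [_ _ _ I'] := sgn_xstate X'.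
rewrite saddleE small_apart ?inside_corner // (sgn_small E) ?inside_corner //.
rewrite (I' (inl (ne a (fa L)))) ?inside_corner //.
have -> : inside_sign L (mark S' a) (mark S' b) (mark S' c) (small S') S' = sgn S' B1.
  by have /and3P[/eqP -> /eqP -> /eqP ->] := E'.
congr ((nat_of_bool _)%:R * _); apply/agreeP/agreeP => H w wI uw vw; apply: H => //.
- by rewrite inE.
- by rewrite small_apart ?inside_corner.
- by move: uw; rewrite small_apart ?inside_corner.
Qed.

Lemma saddle_c S S' : is_E true false true S -> is_E true false false S' ->
    same_out_marks L S S' ->
  dsaddle c S S' = (agree ins T2 T2 S S')%:R * mul_coef s t (sgn S T2) (small S)
    (sgn S' T2).
Proof.
move=> E E' m; have X := xstate_is_E E isT; have X' := xstate_is_E E' isT.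
have /and3P[_ _ /eqP Sc] := E.
rewrite (saddle_corner s t (fc L) Sc (eqP (etrans (mark_make_neg_c _ E)
  (introT andP (conj E' m))))).
rewrite saddleE same_circle_sym small_apart ?inside_corner // (sgn_small E (u :=
  inl (sw c _))) ?inside_corner //.
congr ((nat_of_bool _)%:R * _); apply/agreeP/agreeP => H w wI uw vw; apply: H => //.
- by rewrite inE.
- by rewrite small_apart ?inside_corner.
- by move: vw; rewrite small_apart ?inside_corner.
Qed.

Lemma saddle_b_small S S' : is_E true true true S -> is_E true false true S' ->
    same_out_marks L S S' -> small S' ->
  dsaddle b S S' = (same_out L S S')%:R.
Proof.
move=> E E' m s'; rewrite saddle_b // s' -(same_outP (u := T3)) ?inside_terminal //.
- by case: agree; rewrite ?mul0r // mul1r /comul_coef; case: (sgn S T3); case: (sgn S' T3).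
- exact: xstate_is_E E isT.
- exact: xstate_is_E E' isT.
Qed.

Lemma saddle_a_small S S' : is_E true false true S -> is_E false false true S' ->
    same_out_marks L S S' -> ~~ small S ->
  dsaddle a S S' = (same_out L S S')%:R.
Proof.
move=> E E' m s'; rewrite saddle_a // (negPf s') -(same_outP (u := B1)) ?inside_terminal //.
- by case: agree; rewrite ?mul0r // mul1r /mul_coef; case: (sgn S B1); case: (sgn S' B1).
- exact: xstate_is_E E isT.
- exact: xstate_is_E E' isT.
Qed.

Lemma saddle_c_small S S' : is_E true false true S -> is_E true false false S' ->
    same_out_marks L S S' -> ~~ small S ->
  dsaddle c S S' = (same_out L S S')%:R.
Proof.
move=> E E' m s'; rewrite saddle_c // (negPf s') -(same_outP (u := T2)) ?inside_terminal //.
- by case: agree; rewrite ?mul0r // mul1r /mul_coef; case: (sgn S T2); case: (sgn S' T2).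
- exact: xstate_is_E E isT.
- exact: xstate_is_E E' isT.
Qed.

(** The small circle does not pass through [y], so a saddle there preserves its sign. *)
Lemma saddle_outer_small S S' y : is_E true false true S -> is_E true false true S' ->
    y \notin [:: a; b; c] -> small S != small S' ->
  dsaddle y S S' = 0.
Proof.
move=> E E' yN Hs; rewrite saddleE (_ : agree _ _ _ _ _ = false) ?mul0r //.
apply/agreeP => /(_ (inl (sw c (fc L)))); rewrite inE.
rewrite !(same_circle_sym _ _ (inl (sw c _))) !circle_small // !inside_other //.
by move=> /(_ isT isT isT) Es; rewrite /small Es eqxx in Hs.
Qed.

(** The saddle at [y] depends on outer circles and outer signs, which partner states share. *)
Lemma saddle_outer al be ga al1 be1 ga1 S S' S1 S1' y :
    is_E al be ga S -> is_E al be ga S' -> xmarks al be ga ->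
    ([&& al, ~~ be & ga] -> small S = small S') ->
    is_E al1 be1 ga1 S1 -> is_E al1 be1 ga1 S1' -> xmarks al1 be1 ga1 ->
    ([&& al1, ~~ be1 & ga1] -> small S1 = small S1') ->
    same_out L S S1 -> same_out L S' S1' -> y \notin [:: a; b; c] ->
  dsaddle y S S' = dsaddle y S1 S1'.
Proof.
(* The comparison at inner ends follows from the one at a boundary point on their circle, or from
   the equality assumed on the small circle. *)
have drop_inside al0 be0 ga0 S0 S0' : is_E al0 be0 ga0 S0 -> is_E al0 be0 ga0 S0' ->
    xmarks al0 be0 ga0 -> ([&& al0, ~~ be0 & ga0] -> small S0 = small S0') ->
    y \notin [:: a; b; c] ->
    dsaddle y S0 S0' = saddle ins (inl (y, 0)) (inl (y, 2)) S0 S0'.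
  move=> E E' XX Hs yN; have X := xstate_is_E E XX; have X' := xstate_is_E E' XX.
  apply: saddle_congr => //; apply/agreeP/agreeP => H w wI uw vw.
    by apply: H; rewrite ?inE.
  have [wi|] := boolP (w \in ins); last by move=> wN; apply: H.
  have [_ _ _ I] := sgn_xstate X; have [_ _ _ I'] := sgn_xstate X'.
  have [Esm|nE] := boolP (is_E true false true S0).
    have /and3P[/eqP e1 /eqP e2 /eqP e3] := Esm.
    have /and3P[/eqP f1 /eqP f2 /eqP f3] := E.
    have /and3P[/eqP g1 /eqP g2 /eqP g3] := E'.
    rewrite I // I' // g1 g2 g3 -f1 -f2 -f3 e1 e2 e3 /inside_sign /= Hs //.
    by rewrite -f1 -f2 -f3 e1 e2 e3.
  have ci := circle_inside X (negPf nE) wi.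
  rewrite I // I' //; move: E E' => /and3P[/eqP Ea /eqP Eb /eqP Ec].
  move=> /and3P[/eqP -> /eqP -> /eqP ->]; rewrite Ea Eb Ec in ci *.
  have {nE} nE : ~~ [&& al0, ~~ be0 & ga0].
    by apply: contra nE; rewrite /is_E Ea Eb Ec;
      case: al0 be0 ga0 {XX Hs ci Ea Eb Ec} => [] [] [].
  move: ci; rewrite /inside_sign.
  by case: al0 be0 ga0 nE XX {Hs Ea Eb Ec} => [] [] [] //= _ _ ci; apply: H;
    rewrite ?inside_terminal // -(circle_eqr _ ci).
move=> E E' XX Hs E1 E1' XX1 Hs1 SS1 SS1' yN.
rewrite (drop_inside _ _ _ _ _ E E' XX Hs yN) (drop_inside _ _ _ _ _ E1 E1' XX1 Hs1 yN).
have X := xstate_is_E E XX; have X1 := xstate_is_E E1 XX1.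
have yi j : inl (y, j) \notin ins by rewrite inside_other.
have sE u w : u \notin ins -> w \notin ins -> sc S u w = sc S1 u w.
  by move=> uN wN; apply: (same_circle_xstate X X1 (same_outW SS1)).
apply: saddle_congr; rewrite ?sE ?(same_out_sgn SS1) ?(same_out_sgn SS1') //.
by apply/agreeP/agreeP => H w wI uw vw; have := H w wI; rewrite ?sE // ?(same_out_sgn SS1)
  ?(same_out_sgn SS1') // in uw vw *; apply.
Qed.

(** * The configurations [E_{-++}] and [E_{++-}], and the single saddles of [rho3] *)

Lemma sgn_site S : exists2 sg : dart D -> bool, (forall d, sgn S (inl d) = sg d) &
  [/\ forall x f, mark S x -> sg (nw x f) = sg (ne x f) /\ sg (se x f) = sg (sw x f),
      forall x f, mark S x = false ->
        sg (se x f) = sg (ne x f) /\ sg (sw x f) = sg (nw x f)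
    & [/\ sg (nw a (fa L)) = sg (sw c (fc L)),
  sg (nw b (fb L)) = sg (se c (fc L)) &
  sg (sw b (fb L)) = sg (ne a (fa L))]].
Proof.
exists (fun d => sgn S (inl d)) => //; split; last exact: sgn_glue_site.
  by move=> x f /(sgn_pos f)[].
by move=> x f /(sgn_neg f)[].
Qed.

Lemma sgn_E_mpp S : is_E false true true S ->
  [/\ sgn S T2 = sgn S T1, sgn S B1 = sgn S T3, sgn S B3 = sgn S B2 &
    forall d, inl d \in ins -> sgn S (inl d) = sgn S
      (if d \in [:: ne a (fa L); sw b (fb L)] then B2 else T3)].
Proof.
case/and3P=> /eqP Ma /eqP Mb /eqP Mc.
have [sg sgE [pos neg [G1 G2 G3]]] := sgn_site S.
have [A1 A2] := neg _ (fa L) Ma; have [E1 E2] := pos _ (fb L) Mb.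
have [C1 C2] := pos _ (fc L) Mc.
have [b2 t3] : sgn S B2 = sg (se a (fa L)) /\ sgn S T3 = sg (ne b (fb L)).
  by rewrite -!sgE.
split; try (rewrite /Defs.T1 /Defs.T2 /Defs.T3 /Defs.B1 /Defs.B2 /Defs.B3 !sgE; congruence).
move=> d; rewrite in_inside fun_if b2 t3 sgE => di; case: ifP => [|/negP dN].
  by rewrite !inE => /orP[] /eqP ->; congruence.
move: di dN; rewrite 6!in_cons in_nil orbF.
by do ![case/orP]; move=> /eqP -> {d} H;
  first [congruence | by case: H; rewrite !inE eqxx ?orbT].
Qed.

Lemma circle_E_mpp S : is_E false true true S ->
  [/\ sc S T2 T1, sc S B1 T3, sc S B3 B2 & forall d, inl d \in ins -> sc S (inl d)
      (if d \in [:: ne a (fa L); sw b (fb L)] then B2 else T3)].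
Proof.
move=> E; have H S' : mark S' = mark S -> is_E false true true S' by rewrite /is_E => ->.
split; try by apply/same_circleP => S' /H/sgn_E_mpp[].
by move=> d di; apply/same_circleP => S' /H/sgn_E_mpp[_ _ _]; apply.
Qed.

Lemma sgn_E_ppm S : is_E true true false S ->
  sgn S T2 = sgn S T3 /\ sgn S (inl (sw c (fc L))) = sgn S T1.
Proof.
case/and3P=> /eqP Ma /eqP Mb /eqP Mc.
have [sg sgE [pos neg [G1 G2 G3]]] := sgn_site S.
have [A1 A2] := pos _ (fa L) Ma; have [E1 E2] := pos _ (fb L) Mb.
have [C1 C2] := neg _ (fc L) Mc.
by rewrite /Defs.T1 /Defs.T2 /Defs.T3 !sgE; split; congruence.
Qed.

Lemma circle_E_ppp S : is_E true true true S ->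
  forall u, u \in ins -> sc S u T3.
Proof.
move=> E u ui; have := circle_inside (xstate_is_E E isT) _ ui.
by have /and3P[/eqP Sa /eqP Sb /eqP Sc] := E; rewrite Sa Sc; apply;
  rewrite /Defs.is_E Sb /= !andbF.
Qed.

(** The saddle takes NE of [a] from the arc of [T3] to that of [B2], and SW the other way, so the
    merge-or-split alternative at [a] becomes one for [T3] and [B2]. *)
Lemma circle_move_a S1 S' :
    is_E true true true S1 -> is_E false true true S' -> same_out_marks L S1 S' ->
  [/\ mark S' = make_neg (mark S1) a, sc S' (inl (ne a (fa L))) B2
    & sc S' T3 B2 = ~~ sc S1 T3 B2].
Proof.
move=> E1 E' m; have X1 := xstate_is_E E1 isT; have /and3P[/eqP Sa _ _] := E1.
have mS' : mark S' = make_neg (mark S1) a by apply/eqP; rewrite (mark_make_neg_a _ E1) E'.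
have cne : sc S1 (inl (ne a (fa L))) T3 by rewrite circle_E_ppp ?inside_corner.
have [_ _ cB] := circle_xstate X1; have [_ yB _ yI] := circle_E_mpp E'.
have yne : sc S' (inl (ne a (fa L))) B2.
  by have := yI (ne a (fa L)); rewrite inside_corner mem_head; apply.
split=> //; have := circle_corner (fa L) Sa mS'.
by rewrite (circle_eql yne) same_circle_sym (circle_eql yB)
  (circle_eql cne) -(circle_eqr _ cB).
Qed.

(** Matches the saddle at [a] on [S1], the term of [h3 S], with a term of [to_Ea]. Both rearrange
    the same outer arcs, but the ends of [a] exchange their arcs while [T3] and [B2] keep theirs. *)
Lemma saddle_to_Ea S1 S S' :
    is_E true true true S1 -> is_E true false true S -> is_E false true true S' ->
    same_out L S1 S -> same_out_marks L S1 S' ->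
  dsaddle a S1 S' = saddle_ab s t L S S'.
Proof.
move=> E1 E E' SS1 m; have X1 := xstate_is_E E1 isT; have X := xstate_is_E E isT.
have /and3P[/eqP Sa _ _] := E1; have [mS' yne yx] := circle_move_a E1 E' m.
rewrite (saddle_corner s t (fa L) Sa mS').
have ci := circle_E_ppp E1.
have cne : sc S1 (inl (ne a (fa L))) T3 by rewrite ci ?inside_corner.
have [_ _ cB] := circle_xstate X1; have [_ yB _ _] := circle_E_mpp E'.
have sE u w : u \notin ins -> w \notin ins -> sc S1 u w = sc S u w.
  by move=> uN wN; apply: (same_circle_xstate X1 X (same_outW SS1)).
have Esc : sc S1 (inl (ne a (fa L))) (inl (sw a (fa L))) = sc S1 T3 B2.
  by rewrite (circle_eql cne) (circle_eqr _ cB).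
apply: saddle_congr_swap.
- apply/agreeP/agreeP => H w wI uw vw.
    rewrite (same_out_sgn SS1) // H ?inE //.
      by rewrite (circle_eql cne) sE ?inside_terminal.
    by rewrite -(circle_eql cB) sE ?inside_terminal.
  have wN : w \notin ins by apply: contra uw => /ci;
    rewrite (circle_eql cne) same_circle_sym.
  rewrite -(same_out_sgn SS1) // H // -sE ?inside_terminal //.
    by rewrite -(circle_eql cne).
  by rewrite (circle_eql cB).
- by rewrite Esc sE ?inside_terminal.
- by rewrite (sgn_circle cne) (same_out_sgn SS1) ?inside_terminal.
- by rewrite -(sgn_circle cB) (same_out_sgn SS1) ?inside_terminal.
- exact: sgn_circle yne.
- exact: sgn_circle yB.
- by rewrite -(circle_corner _ Sa mS') => /sgn_circle.
Qed.

Lemma saddle_to_Ec S1 S S' :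
    is_E true true true S1 -> is_E true false true S -> is_E true true false S' ->
    same_out L S1 S -> same_out_marks L S1 S' ->
  dsaddle c S1 S' = saddle_bc s t L S S'.
Proof.
move=> E1 E E' SS1 m; have X1 := xstate_is_E E1 isT; have X := xstate_is_E E isT.
have /and3P[_ _ /eqP Sc] := E1.
have mS' : mark S' = make_neg (mark S1) c by apply/eqP; rewrite (mark_make_neg_c _ E1) E'.
rewrite (saddle_corner s t (fc L) Sc mS'); have ci := circle_E_ppp E1.
have csw : sc S1 (inl (sw c (fc L))) T3 by rewrite ci ?inside_corner.
have [cT _ _] := circle_xstate X1; have [zT zsw] := sgn_E_ppm E'.
have sE u w : u \notin ins -> w \notin ins -> sc S1 u w = sc S u w.
  by move=> uN wN; apply: (same_circle_xstate X1 X (same_outW SS1)).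
have Esc : sc S1 (inl (sw c (fc L))) (inl (ne c (fc L))) = sc S1 T3 T1.
  by rewrite (circle_eql csw) (circle_eqr _ cT).
have X' := circle_corner (fc L) Sc mS'.
(* SW of [c] is on the arc of [T3], the first reference point of [saddle_bc]. *)
rewrite saddleC; last by rewrite -X' => /sgn_circle.
apply: saddle_congr_swap.
- apply/agreeP/agreeP => H w wI uw vw.
    rewrite (same_out_sgn SS1) // H ?inE //.
      by rewrite (circle_eql csw) sE ?inside_terminal.
    by rewrite (circle_eql cT) sE ?inside_terminal.
  have wN : w \notin ins by apply: contra uw => /ci;
    rewrite (circle_eql csw) same_circle_sym.
  rewrite -(same_out_sgn SS1) // H // -sE ?inside_terminal //.
    by rewrite -(circle_eql csw).
  by rewrite -(circle_eql cT).
- by rewrite Esc sE ?inside_terminal.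
- by rewrite (sgn_circle csw) (same_out_sgn SS1) ?inside_terminal.
- by rewrite (sgn_circle cT) (same_out_sgn SS1) ?inside_terminal.
- exact: zsw.
- exact: zT.
- by rewrite same_circle_sym -X' => /sgn_circle ->.
Qed.

(** [E_{--+}] and [E_{+-+}] join the boundary points alike, so a saddle at [b] into the first is a
    term of [to_Eb] into the second. Here NE of [b] is [T3] itself and SW stays on the arc of
    [B2]. *)
Lemma saddle_to_Eb S S' S1 :
    is_E false true true S -> is_E false false true S' -> is_E true false true S1 ->
    same_out_marks L S S' -> same_out L S' S1 ->
  dsaddle b S S' = saddle_ab s t L S S1.
Proof.
move=> E E' E1 m SS1; have X' := xstate_is_E E' isT.
have /and3P[/eqP Sa /eqP Sb /eqP Sc] := E.
have mS' : mark S' = make_neg (mark S) b by apply/eqP; rewrite (mark_make_neg_b _ E) E'.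
rewrite (saddle_corner s t (fb L) Sb mS').
have [_ _ _ yI] := circle_E_mpp E.
have ysw : sc S (inl (sw b (fb L))) B2.
  by have := yI (sw b (fb L)); rewrite inside_corner !inE eqxx orbT; apply.
have csw : sc S' (inl (sw b (fb L))) B2.
  have [_ _ cB] := circle_xstate X'; rewrite (circle_eqr _ cB).
  have /and3P[/eqP Sa' /eqP Sb' /eqP Sc'] := E'.
  have := circle_inside X' _ (inside_corner L).1.1.1.2.
  by rewrite Sa' Sc'; apply; rewrite /Defs.is_E Sa'.
apply: saddle_congr.
- apply/agreeP/agreeP => H w wI uw vw.
    by rewrite (same_out_sgn SS1) // H ?inE // (circle_eql ysw).
  have wN : w \notin ins.
    case: w wI uw vw => [d|i] wI uw vw; last by rewrite inr_inside.
    apply/negP => /yI; case: ifP => _; rewrite same_circle_sym.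
      by rewrite -(circle_eql ysw) (negPf vw).
    by rewrite (negPf uw).
  by rewrite -(same_out_sgn SS1) // H // -(circle_eql ysw).
- by rewrite (circle_eqr _ ysw).
- by [].
- exact: sgn_circle ysw.
- by rewrite (same_out_sgn SS1) ?inside_terminal.
- by rewrite (sgn_circle csw) (same_out_sgn SS1) ?inside_terminal.
Qed.

(** Describes the intermediate states of the double saddle from [S]. Only the circles of [T3] and
    [B2] are rearranged, so such a state is a sign for each new arc, equal when the arcs share a
    circle, and may keep the signs of [S] elsewhere. *)
Lemma E_mpp_states S : is_E true false true S ->
  exists m : {ffun crossing D -> bool}, [/\
    forall S', is_E false true true S' && same_out_marks L S S' = (mark S' == m),
    same_circle m T3 B2 = ~~ sc S T3 B2,
    forall w, w \notin ins ->
      same_circle m T3 w || same_circle m B2 w = sc S T3 w || sc S B2 w &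
    forall e f : bool, (same_circle m T3 B2 -> e = f) ->
      exists2 S', mark S' = m & forall w, sgn S' w =
        if same_circle m T3 w then e else if same_circle m B2 w then f else sgn S w].
Proof.
move=> E; have X := xstate_is_E E isT.
have [S1 /andP[E1 SS1] _] := fit_ex false (isT : xmarks true true true) X.
have X1 := xstate_is_E E1 isT; have /and3P[/eqP S1a /eqP S1b /eqP S1c] := E1.
have m1 := same_outW SS1.
pose m := make_neg (mark S1) a.
have mP S' : is_E false true true S' && same_out_marks L S S' = (mark S' == m).
  rewrite (mark_make_neg_a _ E1); congr (_ && _); apply/idP/idP => H.
    by apply: same_out_marks_trans H; rewrite same_out_marks_sym.
  exact: same_out_marks_trans m1 H.
(* The lemmas on circles take states; any state with markers [m] will do. *)
have [//|//|S0 mS0 _] := @estate_ex D m (fun _ => true).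
have := mP S0; rewrite mS0 eqxx => /andP[E0 m0].
have [yT yB1 yB3 yI] := circle_E_mpp E0; rewrite mS0 in yT yB1 yB3 yI.
have [cT cB3 cB] := circle_xstate X.
have /and3P[/eqP S0a /eqP S0b /eqP S0c] := E0; rewrite mS0 in S0a S0b S0c.
have /and3P[/eqP Sa /eqP Sb /eqP Sc] := E.
have smo d : d.1 \notin [:: a; b; c] -> smooth m d = smooth (mark S) d.
  by move=> dN; rewrite /smooth -mS0 (same_out_mark m0).
pose U w := same_circle m T3 w || same_circle m B2 w.
have Uins d : inl d \in ins -> U (inl d).
  by move/yI; rewrite /U 2!(same_circle_sym m _ (inl d)); case: ifP => _ ->; rewrite ?orbT.
have [UT3 UB2] : U T3 /\ U B2 by rewrite /U; split; rewrite same_circle_refl ?orbT.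
have [UB1 UB3] : U B1 /\ U B3.
  by rewrite /U 2!(circle_eqr _ yB1) 2!(circle_eqr _ yB3).
have UT : U T2 = U T1 by rewrite /U !(circle_eqr _ yT).
have ma d : d.1 = a -> U (inl d).
  by move: d; apply: (@corner_ind D a (fa L)); by [|exact: UB2|apply: Uins;
    rewrite inside_corner].
have mb d : d.1 = b -> U (inl d).
  by move: d; apply: (@corner_ind D b (fb L)); by [|exact: UB3|apply: Uins;
    rewrite inside_corner].
exists m; split=> //.
- have SS : same_out L S1 S by rewrite same_out_sym.
  have [_ _ mx] := circle_move_a E1 E0 (same_out_marks_trans (same_outW SS) m0).
  rewrite -mS0 mx; congr (~~ _).
  by apply: (same_circle_xstate X1 X); rewrite ?inside_terminal // same_out_marks_sym.
- move=> w wN; apply/idP/idP => H.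
    (* The circles of [T3] and [B2] in [S], with the inner ends added, form a set closed under
       gluing and the smoothing by [m]; conversely [U] is closed under the smoothing of [S]. *)
    pose A w := [|| w \in ins, sc S T3 w | sc S B2 w].
    have AT : A T2 = A T1 by rewrite /A !(circle_eqr _ cT) !inside_terminal.
    have A3 : A T3 by rewrite /A same_circle_refl orbT.
    have A2 : A B2 by rewrite /A same_circle_refl !orbT.
    have A1 : A B1 by rewrite /A -!(circle_eqr _ cB) same_circle_refl !orbT.
    have AB3 : A B3 by rewrite /A (circle_eqr _ cB3) same_circle_refl !orbT.
    have Ai d : inl d \in ins -> A (inl d) by rewrite /A => ->.
    have ind : forall u v, same_circle m u v -> A u = A v.
      apply: same_circle_ind => d.
        by rewrite /A glue_inside -!(circle_eqr _ (same_circle_glue _ d)).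
      have [di|dN] := boolP (d.1 \in [:: a; b; c]); last first.
        by rewrite smo // /A !inside_other // -!(circle_eqr _ (same_circle_smooth _ d)).
      have {di} : [|| d.1 == a, d.1 == b | d.1 == c] by move: di; rewrite !inE.
      have Aa d0 : d0.1 = a -> A (inl d0).
        by move: d0; apply: (@corner_ind D a (fa L)); by [|exact: A2|apply: Ai;
          rewrite inside_corner].
      have Ab d0 : d0.1 = b -> A (inl d0).
        by move: d0; apply: (@corner_ind D b (fb L)); by [|exact: AB3|apply: Ai;
          rewrite inside_corner].
      case/or3P=> /eqP dx; [by rewrite !Aa|by rewrite !Ab|move: d dx].
      by apply: (@corner_ind D c (fc L) (fun d => A (inl (smooth m d)) = A (inl d)));
        rewrite smooth_corner S0c;
        by [exact: AT|exact: esym AT|rewrite !Ai ?inside_corner].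
    have := orP H; rewrite -[_ || _](_ : A w = _); last by rewrite /A (negPf wN).
    by case=> /ind <-.
  have ind : forall u v, sc S u v -> U u = U v.
    apply: same_circle_ind => d.
      by rewrite /U -!(circle_eqr _ (same_circle_glue _ d)).
    have [di|dN] := boolP (d.1 \in [:: a; b; c]); last first.
      by rewrite -smo // /U -!(circle_eqr _ (same_circle_smooth _ d)).
    have {di} : [|| d.1 == a, d.1 == b | d.1 == c] by move: di; rewrite !inE.
    case/or3P=> /eqP dx; [by rewrite !ma|by rewrite !mb|move: d dx].
    by apply: (@corner_ind D c (fc L) (fun d => U (inl (smooth (mark S) d)) = U (inl d)));
      rewrite smooth_corner Sc;
      by [exact: UT|exact: esym UT|rewrite !Uins ?inside_corner].
  by rewrite -/(U w); case/orP: H => /ind <-.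
- move=> e f ef; apply: estate_ex => d.
    by rewrite -!(circle_eqr _ (same_circle_glue _ d)) sgn_glue.
  rewrite -!(circle_eqr _ (same_circle_smooth m d)).
  have [di|dN] := boolP (d.1 \in [:: a; b; c]); last by rewrite smo // sgn_smooth.
  have {di} : [|| d.1 == a, d.1 == b | d.1 == c] by move: di; rewrite !inE.
  have [ET _ _ _] := sgn_xstate X.
  (* [d0] selects the circle and [d1] is where the sign of [S] is read. *)
  pose g d0 d1 := if same_circle m T3 (inl d0) then e
    else if same_circle m B2 (inl d0) then f else sgn S (inl d1).
  rewrite -/(g d (smooth m d)) -/(g d d).
  have gU d0 d1 d2 : U (inl d0) -> g d0 d1 = g d0 d2.
    by rewrite /U /g; case: (same_circle _ _ _) => //= ->.
  have gE d0 d1 d2 : sgn S (inl d1) = sgn S (inl d2) -> g d0 d1 = g d0 d2.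
    by rewrite /g => ->.
  case/or3P=> /eqP dx; [by apply: gU; rewrite ma|by apply: gU; rewrite mb|].
  move: d dx; apply: (@corner_ind D c (fc L) (fun d => g d (smooth m d) = g d d));
    rewrite smooth_corner S0c;
    by [exact: gE ET|exact: gE (esym ET)|apply: gU; rewrite Uins ?inside_corner].
Qed.

(** Relates the one-circle conditions in [saddle_a] and [saddle_b] to the two-circle condition of
    the double saddle. *)
Lemma agree_split u v S S' : u \notin ins -> v \notin ins ->
    (forall w, w \notin ins -> sc S' v w = sc S v w) -> ~~ sc S u v ->
  agree ins u u S S' = agree ins u v S S' && (sgn S' v == sgn S v).
Proof.
move=> uN vN E uv; apply/agreeP/andP => [H|[/agreeP H /eqP Ev] w wN uw _].
  split; last by rewrite H.
  by apply/agreeP => w wN uw _; apply: H.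
have [vw|nvw] := boolP (sc S v w); last exact: H.
rewrite -(sgn_circle vw) -Ev; apply/esym/sgn_circle.
by rewrite E.
Qed.

Lemma sum_by_signs (F : estate D -> R) (P : pred (estate D)) u v :
  \sum_(S | P S) F S = \sum_(e : bool) \sum_(f : bool)
    \sum_(S | P S && ((sgn S u == e) && (sgn S v == f))) F S.
Proof.
rewrite (partition_big (fun S => sgn S u) predT) //=; apply: eq_bigr => e _.
rewrite (partition_big (fun S => sgn S v) predT) //=; apply: eq_bigr => f _.
by apply: eq_bigl => S; rewrite andbA.
Qed.

(** If the arcs of [T3] and [B2] share a circle in [S], the double saddle splits and then merges;
    otherwise it merges and then splits. With D_-(+) = t(-) and D_-(-) = (+) - s(-), the two cases
    are m(Delta(p)) = D_-(p) + m(+:p) and Delta(m(p:q)) = D_-(p) ⊗ q + p ⊗ m(+:q). *)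
Lemma double_saddle S S1 S2 S'' :
    is_E true false true S -> small S -> is_E true false true S'' -> ~~ small S'' ->
    is_E true true true S1 -> is_E false false true S2 ->
    same_out_marks L S S'' -> same_out L S S1 -> same_out L S'' S2 ->
  \sum_(S' | is_E false true true S' && same_out_marks L S S')
     saddle_ab s t L S S' * saddle_ab s t L S' S''
  = dsaddle b S1 S'' + dsaddle a S S2.
Proof.
move=> E sm E'' sm'' E1 E2 m SS1 SS2.
have X := xstate_is_E E isT; have X'' := xstate_is_E E'' isT.
have X1 := xstate_is_E E1 isT; have X2 := xstate_is_E E2 isT.
have mE : mark S'' = mark S by apply/esym/(eq_mark E E'').
have [_ _ cB] := circle_xstate X.
rewrite saddle_b //; last first.
  by apply: same_out_marks_trans m; rewrite same_out_marks_sym; apply: same_outW.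
rewrite saddle_a //; last exact: same_out_marks_trans m (same_outW SS2).
rewrite (negPf sm'') sm !(same_out_sgn SS1) ?(same_out_sgn SS2) ?inside_terminal //.
have -> : agree ins T3 T3 S1 S'' = agree ins T3 T3 S S''.
  have sE w : w \notin ins -> sc S1 T3 w = sc S T3 w.
    move=> wN; rewrite (same_circle_xstate X X1 (same_outW SS1)) ?inside_terminal //.
  apply/agreeP/agreeP => H w wN nb _.
    by rewrite -(same_out_sgn SS1) // H // sE.
  by rewrite (same_out_sgn SS1) // H // -sE.
have -> : agree ins B1 B1 S S2 = agree ins B2 B2 S S''.
  apply/agreeP/agreeP => H w wN nb _.
    by rewrite -(same_out_sgn SS2) // H // -(circle_eql cB).
  by rewrite (same_out_sgn SS2) // H // (circle_eql cB).
have cB'' : sc S'' B2 B1 by rewrite mE.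
rewrite -(sgn_circle cB) -(sgn_circle cB'').
have [y [yP yx yU yex]] := E_mpp_states E.
set A := agree ins T3 B2 S S''; set x := sc S T3 B2.
(* The product of the two coefficients when the intermediate signs at [T3] and [B2] are [e] and
   [f]. *)
pose G e f : R := A%:R * (if x then comul_coef s t
  (sgn S T3) e f * mul_coef s t e f (sgn S'' T3)
  else mul_coef s t (sgn S T3) (sgn S B2) e * comul_coef s t e (sgn S'' T3) (sgn S'' B2)).
have sumG e f : (~~ x -> e = f) ->
    \sum_(S' | (is_E false true true S' && same_out_marks L S S') &&
               ((sgn S' T3 == e) && (sgn S' B2 == f)))
      saddle_ab s t L S S' * saddle_ab s t L S' S'' = G e f.
  move=> ef; have [|N mN NE] := yex e f; first by rewrite yx.
  have NT3 : sgn N T3 = e by rewrite NE same_circle_refl.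
  have NB2 : sgn N B2 = f.
    by rewrite NE same_circle_refl yx; case: ifP => // /ef.
  rewrite (bigD1 N) /=; last by rewrite yP mN NT3 NB2 !eqxx.
  rewrite big1 ?addr0.
    rewrite /saddle_ab !saddleE mN yx NT3 NB2 -/x.
    have -> : agree ins T3 B2 S N.
      apply/agreeP => w wN /negPf tw /negPf bw; have := yU w wN; rewrite tw bw NE.
      by case: ifP => //; case: ifP.
    have -> : agree ins T3 B2 N S'' = A.
      apply/agreeP/agreeP => H w wN /negPf tw /negPf bw.
        have := yU w wN; rewrite tw bw => /negbT; rewrite negb_or => /andP[ty by_].
        by rewrite H ?mN // NE (negPf ty) (negPf by_).
      have := yU w wN; rewrite mN in tw bw; rewrite tw bw => /esym/negbT.
      by rewrite negb_or NE tw bw => /andP[ty by_]; apply: H.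
    by rewrite mul1r mulrCA /G; case: (x).
  (* Another state with these two signs differs from [S] away from the circles of the saddle, so its
     coefficient is 0. *)
  move=> S' /andP[/andP[yS' /andP[/eqP e3 /eqP e2]] nS'].
  rewrite /saddle_ab saddleE (_ : agree _ _ _ _ _ = false) ?mul0r //.
  apply: contraNF nS' => /agreeP H; apply/eqP; have /eqP mS' : mark S' == y by rewrite -yP.
  apply: estate_eq => [|w]; first by rewrite mN.
  rewrite NE; case: ifP => [tw|ntw]; first by rewrite -e3; apply/esym/sgn_circle;
    rewrite mS'.
  case: ifP => [bw|nbw]; first by rewrite -e2; apply/esym/sgn_circle; rewrite mS'.
  have wN : w \notin ins.
    apply/negP => wi; have /andP[E' _] : is_E false true true S' && same_out_marks L
      S S' by [].
    have [_ _ _ yI] := circle_E_mpp E'; case: w wi ntw nbw => [d|i];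
      last by rewrite inr_inside.
    by move/yI; rewrite mS'; case: ifP => _; rewrite same_circle_sym => ->.
  by have := yU w wN; rewrite ntw nbw => /esym/negbT; rewrite negb_or => /andP[]; apply: H.
rewrite (sum_by_signs _ _ T3 B2).
have sum0 e f : x = false -> e != f ->
    \sum_(S' | (is_E false true true S' && same_out_marks L S S') &&
               ((sgn S' T3 == e) && (sgn S' B2 == f)))
      saddle_ab s t L S S' * saddle_ab s t L S' S'' = 0.
  move=> x0 ef; apply: big_pred0 => S'; apply: contraNF ef.
  case/andP; rewrite yP => /eqP mS' /andP[/eqP <- /eqP <-].
  by apply/eqP/sgn_circle; rewrite mS' yx -/x x0.
rewrite !big_bool /=; case Ex: x.
  rewrite !sumG ?Ex // /G Ex.
  have cAx v : v \notin ins -> sc S T3 v -> agree ins v v S S'' = A.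
    move=> vN tv; have E3 := circle_eql tv; have EB := circle_eql (Ex : sc S T3 B2).
    by apply/agreeP/agreeP => H w wN tw bw; apply: H; rewrite -?E3 -?EB // ?E3.
  rewrite (cAx T3) ?same_circle_refl ?inside_terminal // (cAx B2) ?inside_terminal //.
  have <- : sgn S T3 = sgn S B2 by apply: sgn_circle.
  have <- : sgn S'' T3 = sgn S'' B2 by apply: sgn_circle; rewrite mE.
  rewrite /comul_coef /mul_coef; case: (sgn S T3); case: (sgn S'' T3); case: (A) => /=;
    ring.
rewrite sumG ?Ex // (sum0 true false) // (sum0 false true) // sumG ?Ex // /G Ex.
have sE v w : sc S'' v w = sc S v w by rewrite mE.
have -> : agree ins T3 T3 S S'' = A && (sgn S'' B2 == sgn S B2).
  by apply: agree_split; rewrite ?inside_terminal // -/x Ex.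
have -> : agree ins B2 B2 S S'' = A && (sgn S'' T3 == sgn S T3).
  rewrite /A agreeC; apply: agree_split; rewrite ?inside_terminal //.
  by rewrite same_circle_sym -/x Ex.
rewrite /comul_coef /mul_coef.
case: (sgn S T3); case: (sgn S'' T3); case: (sgn S B2); case: (sgn S'' B2);
  case: (A) => /=; ring.
Qed.

(** * Reindexing sums along partner states *)

Implicit Type x : seq (crossing D).

(** Fixing the sign [o] of the small circle, where there is one, leaves the outer signs as the only
    freedom, so admissible states of any two of the four configurations correspond one to one. *)
Definition adm al be ga o S :=
  is_E al be ga S && ([&& al, ~~ be & ga] ==> (small S == o)).

(** [same_out] is the graph of a bijection between the two kinds of admissible states, by [fit_ex]
    and [xstate_eq]; after exchanging the sums each inner one has a single term. *)
Lemma transfer_sum al be ga o al1 be1 ga1 o1 (P Q : pred (estate D))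
    (k k' : estate D -> R) (F : estate D -> chain D R) :
    xmarks al be ga -> xmarks al1 be1 ga1 ->
    (forall S S1, adm al be ga o S -> adm al1 be1 ga1 o1 S1 -> same_out L S S1 ->
       P S = Q S1 /\ (P S -> k S = k' S1)) ->
  \sum_(S | adm al be ga o S && P S)
     k S *: \sum_(S1 | adm al1 be1 ga1 o1 S1 && same_out L S S1) F S1
  = \sum_(S1 | adm al1 be1 ga1 o1 S1 && Q S1) k' S1 *: F S1.
Proof.
move=> X X1 H; under eq_bigr => S _ do rewrite scaler_sumr.
rewrite (exchange_big_dep (fun S1 => adm al1 be1 ga1 o1 S1 && Q S1)) /=; last first.
  by move=> S S1 /andP[AS PS] /andP[A1 SS1]; have [<- _] := H _ _ AS A1 SS1; rewrite A1.
apply: eq_bigr => S1 /andP[A1 Q1]; have XS1 : xstate L S1.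
  by case/andP: A1 => E1 _; apply: xstate_is_E E1 X1.
have [S /andP[ES SS1] IS] := fit_ex o X XS1; rewrite same_out_sym in SS1.
have AS : adm al be ga o S.
  rewrite /adm ES; apply/implyP => /and3P[al_ be_ ga_].
  by rewrite /small IS ?inside_corner // /inside_sign al_ ga_ (negPf be_).
have [PQ kk'] := H _ _ AS A1 SS1; rewrite (big_pred1 S) ?kk' ?PQ // => S'.
apply/andP/eqP => [[/andP[AS' _] /andP[_ SS1']]|->]; last by rewrite AS A1 PQ.
case/andP: AS AS' => _ oS /andP[ES' oS'].
apply: (xstate_eq ES' ES X) => [|i].
  by apply: same_out_trans SS1' _; rewrite same_out_sym.
by move: oS oS'; rewrite i => /eqP -> /eqP ->.
Qed.

Lemma make_neg_outer al be ga al1 be1 ga1 S N S' N' y :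
    is_E al be ga S -> is_E al1 be1 ga1 N -> is_E al be ga S' -> is_E al1 be1 ga1 N' ->
    same_out_marks L S N -> same_out_marks L S' N' -> y \notin [:: a; b; c] ->
  mark S' = make_neg (mark S) y -> mark N' = make_neg (mark N) y.
Proof.
move=> ES EN ES' EN' SN SN' yN mS'; apply/ffunP => x; rewrite ffunE.
have [xi|xN] := boolP (x \in [:: a; b; c]); last first.
  by rewrite (same_out_mark SN') // mS' ffunE (same_out_mark SN).
have -> /= : x != y by apply: contraNneq yN => <-.
move: xi EN EN'; rewrite !inE => xi /and3P[/eqP Na /eqP Nb /eqP Nc].
by case/and3P=> /eqP Na' /eqP Nb' /eqP Nc'; case/or3P: xi => /eqP ->; congruence.
Qed.

Lemma is_E_outer al be ga S S' y : is_E al be ga S -> y \notin [:: a; b; c] ->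
  mark S' = make_neg (mark S) y -> is_E al be ga S'.
Proof.
move=> /and3P[/eqP Sa /eqP Sb /eqP Sc] yN mS'; rewrite /is_E mS' !ffunE Sa Sb Sc.
by move: yN; rewrite !inE !(eq_sym y) !negb_or => /and3P[-> -> ->]; rewrite !eqxx.
Qed.

Lemma adm_small al be ga o S S' : adm al be ga o S -> adm al be ga o S' ->
  [&& al, ~~ be & ga] -> small S = small S'.
Proof.
by move=> /andP[_ oS] /andP[_ oS'] i; move: oS oS'; rewrite i => /eqP -> /eqP ->.
Qed.

(** The sum on the right also runs over states with the other sign on the small circle; their saddle
    coefficient is 0. *)
Lemma transfer_outer al be ga o al1 be1 ga1 o1 S N y (F : estate D -> chain D R) :
    xmarks al be ga -> xmarks al1 be1 ga1 ->
    adm al be ga o S -> adm al1 be1 ga1 o1 N -> same_out L S N ->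
    y \notin [:: a; b; c] ->
  \sum_(S' | adm al be ga o S' && (mark S' == make_neg (mark S) y))
     dsaddle y S S' *: \sum_(S1 | adm al1 be1 ga1 o1 S1 && same_out L S' S1) F S1
  = \sum_(S' | mark S' == make_neg (mark N) y) dsaddle y N S' *: F S'.
Proof.
move=> X X1 AS AN SN yN.
rewrite (transfer_sum (Q := fun S' => mark S' == make_neg (mark N) y)
  (k' := fun S1 => dsaddle y N S1)) //; last first.
  move=> S' S1 AS' A1 SS1.
  have [ES _] := andP AS; have [EN _] := andP AN.
  have [ES' _] := andP AS'; have [E1 _] := andP A1.
  split; last first.
    move=> _; exact: (saddle_outer ES ES' X (adm_small AS AS') EN E1 X1
      (adm_small AN A1) SN SS1 yN).
  apply/eqP/eqP.
    by apply: (make_neg_outer ES EN ES' E1) => //; apply: same_outW.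
  by apply: (make_neg_outer EN ES E1 ES') => //; rewrite same_out_marks_sym;
    apply: same_outW.
rewrite [RHS](bigID (adm al1 be1 ga1 o1)) /= [X in _ = _ + X]big1 ?addr0.
  by apply: eq_bigl => S1; rewrite andbC.
move=> S1 /andP[/eqP mS1 nA]; have [EN oN] := andP AN.
have E1 := is_E_outer EN yN mS1; move: nA; rewrite /adm E1 /= negb_imply.
case/andP=> i oS1; rewrite i /= in oN; case/and3P: i E1 EN => -> /negPf -> -> E1 EN.
have ns : small N != small S1 by rewrite (eqP oN) eq_sym.
by rewrite (saddle_outer_small EN E1 yN ns) scale0r.
Qed.

Lemma big_marked (V : nmodType) S (F : crossing D -> V) :
  \sum_(y | mark S y) F y = \sum_(y | mark S y && (y \notin [:: a; b; c])) F y
    + ((if mark S a then F a else 0) + (if mark S b then F b else 0)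
       + (if mark S c then F c else 0)).
Proof.
rewrite (bigID (fun y => y \in [:: a; b; c])) /= addrC; congr (_ + _).
rewrite big_mkcondl /= -big_uniq ?r3_uniq //= !big_cons big_nil addr0 addrA //.
Qed.

(** * The homotopy formula on each type of generator *)

Local Notation h3 := (@h3 R D L).
Local Notation h3_gen := (h3_gen R L).
Local Notation din := (din L).
Local Notation delta := (delta s t).
Local Notation rho3_gen := (rho3_gen s t L).

Lemma dinE al be ga S : is_E al be ga S ->
  din S = (if al then [::] else [:: a]) ++ (if be then [::] else [:: b])
          ++ (if ga then [::] else [:: c]).
Proof.
by rewrite /Defs.din /= => /and3P[/eqP -> /eqP -> /eqP ->]; case: al be ga => [] [] [].
Qed.

Lemma h3_gen0 S x : ~~ is_E false false true S -> ~~ (is_E true false true S && small S) ->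
  h3_gen S x = 0.
Proof. by rewrite /Defs.h3_gen => /negPf -> /negPf ->. Qed.

Lemma h3_0 S l : ~~ is_E false false true S -> ~~ (is_E true false true S && small S) ->
  h3 (gen S l) = 0.
Proof.
move=> nE nE'; rewrite /Defs.h3 /r3_lift /lin_lift big1 // => S' _.
have [->|nS] := eqVneq S' S; first by rewrite h3_gen0 // !scaler0.
by rewrite gen_supp // scale0r.
Qed.

Lemma h3_gen_mmp S x : is_E false false true S ->
  h3_gen S x = - \sum_(S' | adm true false true false S' && same_out L S S')
                    gen S' (x ++ [:: b]).
Proof.
move=> E; rewrite /Defs.h3_gen E cats1; congr (- _); apply: eq_bigl => S'.
by rewrite /adm /= -andbA eqbF_neg.
Qed.

Lemma h3_gen_pmp S x : is_E true false true S -> small S ->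
  h3_gen S x = \sum_(S' | adm true true true false S' && same_out L S S')
                    gen S' (x ++ [::]).
Proof.
move=> E sm; rewrite /Defs.h3_gen E sm cats0; have -> : is_E false false true S = false.
  by move: E; rewrite /Defs.is_E => /and3P[/eqP ->].
by apply: eq_bigl => S'; rewrite /adm /= andbT.
Qed.

Lemma h3_outer al be ga S S' x y : is_E al be ga S -> listing S (x ++ din S) ->
    y \notin [:: a; b; c] -> mark S y -> mark S' = make_neg (mark S) y ->
  h3 (gen S' (rcons (x ++ din S) y)) = (-1) ^+ size (din S) *: h3_gen S' (rcons x y).
Proof.
move=> E H yN Sy mS'; have E' := is_E_outer E yN mS'.
have dS : din S' = din S by rewrite (dinE E) (dinE E').
rewrite -dS gen_rotate linearZ_LR [LHS]/= h3E //.
have := listing_rcons H Sy mS'; rewrite -dS; apply: etrans; apply: listing_perm.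
by rewrite -!cats1 -!catA perm_cat2l perm_catC.
Qed.

(** At an outer [y] the terms of [delta h3] and [h3 delta] have equal saddle coefficients. To
    compare the sequences, [y] is moved past [din N] in one and past [din S] in the other; the
    lengths have different parity, as [h3] removes one negative marker. [k] is the sign in the
    definition of [h3]. *)
Lemma outer_cancel al be ga o al1 be1 ga1 o1 S N x y (k : R) :
    xmarks al be ga -> xmarks al1 be1 ga1 ->
    adm al be ga o S -> adm al1 be1 ga1 o1 N -> same_out L S N ->
    listing S (x ++ din S) -> y \notin [:: a; b; c] -> mark S y ->
    (forall S' x', adm al be ga o S' -> h3_gen S' x' =
      k *: \sum_(S1 | adm al1 be1 ga1 o1 S1 && same_out L S' S1) gen S1 (x' ++ din N)) ->
    (forall S' x', is_E al be ga S' -> ~~ adm al be ga o S' -> h3_gen S' x' = 0) ->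
    odd (size (din S) + size (din N)) ->
  k *: (\sum_(S' | mark S' == make_neg (mark N) y)
          dsaddle y N S' *: gen S' (rcons (x ++ din N) y))
  + \sum_(S' | mark S' == make_neg (mark S) y)
      dsaddle y S S' *: h3 (gen S' (rcons (x ++ din S) y)) = 0.
Proof.
move=> X X1 AS AN SN H yN Sy Hh Hh0 odd_d; have [ES _] := andP AS.
rewrite -(transfer_outer _ X X1 AS AN SN yN) scaler_sumr.
rewrite [X in _ + X](bigID (adm al be ga o)) /= [X in _ + (_ + X)]big1 ?addr0; last first.
  move=> S' /andP[/eqP mS' nA]; rewrite (h3_outer ES) // Hh0 ?scaler0 //.
  exact: is_E_outer ES yN mS'.
under [X in _ + X]eq_bigl => S' do rewrite andbC.
rewrite -big_split big1 //= => S'.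
case/andP=> AS' /eqP mS'; rewrite (h3_outer ES) // Hh // scalerA mulrC -scalerA -scalerDr.
rewrite [X in _ *: X](_ : _ = 0) ?scaler0 //.
rewrite [(-1) ^+ _ *: _]scalerA [_ * k]mulrC -scalerA -scalerDr !scaler_sumr -big_split.
rewrite big1 ?scaler0 //= => S1 _; rewrite gen_rotate -scalerDl -signr_odd
  -(signr_odd _ (size (din S))).
by move: odd_d; rewrite oddD; case: odd; case: odd => //= _; rewrite ?addNr ?subrr scale0r.
Qed.

Lemma listing_outP S x :
  reflect (uniq x /\ forall y, (y \in x) = (y \notin [:: a; b; c]) && ~~ mark S y)
    (listing S (x ++ din S)).
Proof.
have dS y : (y \in din S) = (y \in [:: a; b; c]) && ~~ mark S y.
  by rewrite mem_filter andbC.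
apply: (iffP idP) => [H|[U M]].
  have : uniq (x ++ din S) by rewrite (perm_uniq H) enum_uniq.
  rewrite cat_uniq => /and3P[U /hasPn dis _]; split=> // y.
  have M : (y \in x ++ din S) = ~~ mark S y by rewrite (perm_mem H) mem_enum inE.
  rewrite -M mem_cat dS; have := dis y; rewrite dS -M mem_cat dS /=.
  by case: (y \in x); case: (y \in _); case: (mark S y) => //= ->.
apply: uniq_perm; rewrite ?enum_uniq //.
  rewrite cat_uniq U filter_uniq ?r3_uniq // andbT; apply/hasPn => y.
  by rewrite dS /= M => /andP[-> _].
by move=> y; rewrite mem_cat dS mem_enum [y \in negs S]inE M -andb_orl orNb.
Qed.

Lemma listing_out S S' x : same_out_marks L S S' ->
  listing S (x ++ din S) -> listing S' (x ++ din S').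
Proof.
move=> m /listing_outP[U M]; apply/listing_outP; split=> // y; rewrite M.
by case: (boolP (y \in _)) => //= yN; rewrite (same_out_mark m).
Qed.

Lemma adm_sum (V : nmodType) (F : estate D -> V) al be ga o S S1 :
    xmarks al be ga -> adm al be ga o S1 -> same_out L S S1 ->
  \sum_(S' | adm al be ga o S' && same_out L S S') F S' = F S1.
Proof.
move=> X A1 SS1; apply: big_pred1 => S'; apply/andP/eqP => [[A' SS']|->//].
have [E1 _] := andP A1; have [E' _] := andP A'.
apply: (xstate_eq E' E1 X _ (adm_small A' A1)).
by apply: same_out_trans SS1; rewrite same_out_sym.
Qed.

Lemma adm_ex al be ga o S : xmarks al be ga -> xstate L S ->
  exists2 S', adm al be ga o S' & same_out L S S'.
Proof.
move=> X XS; have [S' /andP[E' SS'] IS'] := fit_ex o X XS; exists S' => //.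
rewrite /adm E'; apply/implyP => /and3P[al_ be_ ga_].
by rewrite /Defs.small IS' ?inside_corner // /inside_sign al_ ga_ (negPf be_).
Qed.

(** Serves when a small circle of sign - is absorbed or one of sign + is split off: the partner
    alone contributes. *)
Lemma adm_saddle_sum (F : estate D -> chain D R) (k : estate D -> R) al be ga o S S1 :
    xmarks al be ga -> adm al be ga o S1 -> same_out L S S1 ->
    (forall S', adm al be ga o S' -> same_out_marks L S S' -> k S' =
      (same_out L S S')%:R) ->
  \sum_(S' | adm al be ga o S' && same_out_marks L S S') k S' *: F S' = F S1.
Proof.
move=> X A1 SS1 H; rewrite -(adm_sum F X A1 SS1).
rewrite (bigID (same_out L S)) /= [X in _ + X]big1 ?addr0.
  apply: eq_big => [S'|S' /andP[/andP[A' m] SS']]; last by rewrite H // SS' scale1r.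
  by rewrite -andbA; congr (_ && _); rewrite /Defs.same_out; case: same_out_marks.
by move=> S' /andP[/andP[A' m] /negPf nS]; rewrite H // nS scale0r.
Qed.

Lemma admE al be ga S o : ~~ [&& al, ~~ be & ga] -> adm al be ga o S = is_E al be ga S.
Proof. by rewrite /adm => /negPf ->; rewrite andbT. Qed.

Definition dterm S l y : chain D R :=
  \sum_(S' | mark S' == make_neg (mark S) y) dsaddle y S S' *: gen S' (rcons l y).

Definition hterm S l y : chain D R :=
  \sum_(S' | mark S' == make_neg (mark S) y) dsaddle y S S' *: h3 (gen S' (rcons l y)).

Lemma delta_terms S l : listing S l -> delta (gen S l) =
  \sum_(y | mark S y && (y \notin [:: a; b; c])) dterm S l y
  + ((if mark S a then dterm S l a else 0) + (if mark S b then dterm S l b else 0)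
     + (if mark S c then dterm S l c else 0)).
Proof. by move=> H; rewrite deltaE // /delta_gen big_marked. Qed.

Lemma h3_dterm S l y : h3 (dterm S l y) = hterm S l y.
Proof. by rewrite linear_sum; apply: eq_bigr => S' _; rewrite linearZ_LR. Qed.

Lemma h3_delta S l : listing S l -> h3 (delta (gen S l)) =
  \sum_(y | mark S y && (y \notin [:: a; b; c])) hterm S l y
  + ((if mark S a then hterm S l a else 0) + (if mark S b then hterm S l b else 0)
     + (if mark S c then hterm S l c else 0)).
Proof.
move=> H; have E y (k : bool) :
    h3 (if k then dterm S l y else 0) = if k then hterm S l y else 0.
  by case: k; rewrite ?h3_dterm // linear0.
rewrite delta_terms // !linearD linear_sum /= !E; congr (_ + _).
by apply: eq_bigr => y _; rewrite h3_dterm.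
Qed.

Lemma hterm0 S l y :
    (forall S', mark S' = make_neg (mark S) y ->
       dsaddle y S S' = 0 \/
       ~~ is_E false false true S' && ~~ (is_E true false true S' && small S')) ->
  hterm S l y = 0.
Proof.
move=> H; apply: big1 => S' /eqP /H[->|/andP[n1 n2]]; first by rewrite scale0r.
by rewrite h3_0 ?scaler0.
Qed.

Lemma hterm_c S l : hterm S l c = 0.
Proof.
apply: hterm0 => S' mS'; right.
by rewrite /Defs.is_E mS' !ffunE eqxx /= !andbF.
Qed.

Lemma is_E_neq al be ga al1 be1 ga1 S : is_E al be ga S ->
  is_E al1 be1 ga1 S = [&& al == al1, be == be1 & ga == ga1].
Proof. by rewrite /Defs.is_E => /and3P[/eqP -> /eqP -> /eqP ->]. Qed.

Definition homotopy_at S := forall x, listing S (x ++ din S) ->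
  delta (h3_gen S x) + h3 (delta (gen S (x ++ din S)))
  = gen S (x ++ din S) - rho3_gen S x.

(** [delta] never makes the marker at [c] positive, and [h3] kills every state where it is
    negative. *)
Lemma homotopy_c_neg S : mark S c = false -> homotopy_at S.
Proof.
move=> Sc x H; have nE be al S' : mark S' c = false -> is_E al be true S' = false.
  by move=> Sc'; rewrite /Defs.is_E Sc' !andbF.
rewrite h3_gen0 ?nE // linear0 add0r h3_delta // /Defs.rho3_gen nE // Sc subrr.
have h0 y : hterm S (x ++ din S) y = 0.
  apply: hterm0 => S' mS'; right; rewrite !nE // mS' ffunE Sc; exact: andbF.
by rewrite big1 // !h0 !if_same !addr0.
Qed.

(** Only the split at [b] meets the support of [h3], in the term with + on the small circle, which
    [h3] sends back to [S]. *)
Lemma homotopy_ppp S : is_E true true true S -> homotopy_at S.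
Proof.
move=> E x H; have X := xstate_is_E E isT.
have dS := dinE E; rewrite /= in dS.
have /and3P[/eqP Sa /eqP Sb /eqP Sc] := E.
rewrite h3_gen0 ?(is_E_neq _ _ _ E) // linear0 add0r.
rewrite /Defs.rho3_gen !(is_E_neq _ _ _ E) Sc /= subr0.
rewrite h3_delta // Sa Sb Sc /= hterm_c addr0 big1 ?add0r; last first.
  move=> y /andP[_ yN]; apply: hterm0 => S' mS'; right.
  by have E' := is_E_outer E yN mS'; rewrite !(is_E_neq _ _ _ E').
rewrite hterm0 ?add0r; last first.
  move=> S' mS'; right; have : is_E false true true S' && same_out_marks L S S'.
    by rewrite -(mark_make_neg_a _ E) mS'.
  by case/andP=> E' _; rewrite !(is_E_neq _ _ _ E').
have [S1 A1 SS1] := adm_ex true (isT : xmarks true false true) X.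
rewrite /hterm (bigID small) /= [X in _ + X]big1 ?addr0; last first.
  move=> S' /andP[/eqP mS' ns]; rewrite h3_0 ?scaler0 // ?(negPf ns) ?andbF //.
  by rewrite /Defs.is_E mS' !ffunE Sa site_neqs.
rewrite (eq_bigl (fun S' => adm true false true true S' && same_out_marks L S S'));
  last first.
  by move=> S'; rewrite (mark_make_neg_b _ E) /adm eqb_id /= andbAC.
rewrite (adm_saddle_sum _ (isT : xmarks true false true) A1 SS1); last first.
  by move=> S' /andP[E' sm'] m; apply: saddle_b_small => //;
    move: sm'; rewrite /= eqb_id.
have [E1 sm1] := andP A1; rewrite eqb_id in sm1.
have d1 : din S1 = [:: b] by rewrite (dinE E1).
rewrite -cats1 dS cats0 -d1 h3E; last first.
  exact: listing_out (same_outW SS1) H.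
rewrite h3_gen_pmp // (adm_sum _ _ (S1 := S)) ?cats0 //; first by rewrite /adm E.
by rewrite same_out_sym.
Qed.

(** [h3] gives minus the partner [N] of type [E^-_{+-+}]. The saddle of [N] at [a] restores [S], the
    one at [c] produces [rho3], and the outer ones cancel. *)
Lemma homotopy_mmp S : is_E false false true S -> homotopy_at S.
Proof.
move=> E x H; have X := xstate_is_E E isT; have dS := dinE E; rewrite /= in dS.
have [N AN SN] := adm_ex false (isT : xmarks true false true) X.
have [EN smN] := andP AN; rewrite eqbF_neg in smN.
have /and3P[/eqP Sa /eqP Sb /eqP Sc] := E; have /and3P[/eqP Na /eqP Nb /eqP Nc] := EN.
have dN : din N = [:: b] by rewrite (dinE EN).
have HN := listing_out (same_outW SN) H.
rewrite h3_gen_mmp // (adm_sum _ (isT : xmarks true false true) AN SN) -dN linearN /=.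
rewrite delta_terms // h3_delta // Sa Sb Sc Na Nb Nc hterm_c !addr0.
have -> : dterm N (x ++ din N) a = - gen S (x ++ din S).
  rewrite dS -[in RHS](cat0s [:: a; b]) gen_swap opprK.
  rewrite -(adm_saddle_sum (o := false) (S := N) (k := fun S' => dsaddle a N S')
     (fun S' => gen S' (x ++ [:: b; a])) (isT : xmarks false false true)).
  - rewrite /dterm; apply: eq_big => [S'|S' _].
      by rewrite (mark_make_neg_a _ EN) admE.
    by rewrite dN -cats1 -catA.
  - by rewrite admE.
  - by rewrite same_out_sym.
  - by move=> S'; rewrite admE // => E' m; apply: saddle_a_small.
have -> : dterm N (x ++ din N) c = rho3_gen S x.
  have [M AM SM] := adm_ex false (isT : xmarks true false false) X.
  rewrite /Defs.rho3_gen !(is_E_neq _ _ _ E) /= Sc /=.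
  transitivity (gen M (x ++ [:: b; c])).
    rewrite -(adm_saddle_sum (o := false) (S := N) (k := fun S' => dsaddle c N S')
       (fun S' => gen S' (x ++ [:: b; c])) (isT : xmarks true false false) AM).
    - rewrite /dterm; apply: eq_big => [S'|S' _].
        by rewrite (mark_make_neg_c _ EN) admE.
      by rewrite dN -cats1 -catA.
    - by apply: same_out_trans SM; rewrite same_out_sym.
    - by move=> S'; rewrite admE // => E' m; apply: saddle_c_small.
  rewrite -(adm_sum (fun S' => gen S' (x ++ [:: b;
    c])) (isT : xmarks true false false) AM SM).
  by apply: eq_bigl => S'; rewrite admE.
rewrite /= opprD [X in _ + X + _]opprD opprK addrAC -sumrN.
rewrite (eq_bigl (fun y => mark S y && (y \notin [:: a; b; c]))); last first.
  move=> y; case: (boolP (y \in _)); rewrite ?andbF // => yN.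
  by rewrite (same_out_mark (same_outW SN)).
rewrite -big_split /= big1 ?add0r // => y /andP[Sy yN].
have AS : adm false false true false S by rewrite admE.
rewrite -scaleN1r; apply: (outer_cancel _ _ AS AN SN H yN Sy) => //.
- by move=> S' x'; rewrite admE // => E'; rewrite h3_gen_mmp // scaleN1r dN.
- by move=> S' x' E'; rewrite admE // E'.
- by rewrite dS dN.
Qed.

(** Two signs cancel: that of exchanging [b, a] into [a, b] and that of [h3] on [E_{--+}]. *)
Lemma hterm_a S x : is_E true false true S -> listing S (x ++ din S) ->
  hterm S (x ++ din S) a =
  \sum_(S' | adm false false true false S' && same_out_marks L S S')
    dsaddle a S S' *: \sum_(S1 | adm true false true false S1 && same_out L S' S1)
      gen S1 (x ++ [:: b]).
Proof.
move=> E H; have dS := dinE E; rewrite /= in dS.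
rewrite /hterm; apply: eq_big => [S'|S' /eqP mS'].
  by rewrite (mark_make_neg_a _ E) admE.
have /andP[E' m] : is_E false false true S' && same_out_marks L S S'.
  by rewrite -(mark_make_neg_a _ E) mS'.
congr (_ *: _); rewrite dS -cats1 -catA gen_swap linearN /=.
have dS' : [:: a; b] = din S' by rewrite (dinE E').
rewrite [X in h3 (gen S' (x ++ X))]dS' h3E; last exact: listing_out m H.
by rewrite h3_gen_mmp // opprK.
Qed.

(** The merge at [a] leads to the partner of type [E_{--+}], which [h3] sends back to [S]; all other
    terms vanish or miss the support of [h3]. *)
Lemma homotopy_pmp_minus S : is_E true false true S -> ~~ small S -> homotopy_at S.
Proof.
move=> E ns x H; have X := xstate_is_E E isT; have dS := dinE E; rewrite /= in dS.
have /and3P[/eqP Sa /eqP Sb /eqP Sc] := E.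
rewrite h3_gen0 ?(is_E_neq _ _ _ E) // linear0 add0r.
rewrite /Defs.rho3_gen !(is_E_neq _ _ _ E) Sc (negPf ns) /= subr0.
rewrite h3_delta // Sa Sb Sc hterm_c !addr0 big1 ?add0r; last first.
  move=> y /andP[_ yN]; apply: hterm0 => S' mS'; have E' := is_E_outer E yN mS'.
  have [s'|s'] := boolP (small S'); [left|right].
    by apply: (saddle_outer_small E E' yN); rewrite s' (negPf ns).
  by rewrite !(is_E_neq _ _ _ E').
have [S0 A0 S0S] := adm_ex false (isT : xmarks false false true) X.
rewrite hterm_a // (adm_saddle_sum _ (isT : xmarks false false true) A0 S0S); last first.
  by move=> S'; rewrite admE // => E' m; apply: saddle_a_small.
have AS : adm true false true false S by rewrite /adm E eqbF_neg ns.
by rewrite (adm_sum _ (isT : xmarks true false true) AS) ?dS // same_out_sym.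
Qed.

(** Only the saddle at [b] lands in the support of [h3], in type [E_{--+}]; moved to partners of
    type [E^-_{+-+}], it is the second term of [rho3] with the sign of [h3]. *)
Lemma homotopy_mpp S : is_E false true true S -> homotopy_at S.
Proof.
move=> E x H; have dS := dinE E; rewrite /= in dS.
have /and3P[/eqP Sa /eqP Sb /eqP Sc] := E.
rewrite h3_gen0 ?(is_E_neq _ _ _ E) // linear0 add0r.
rewrite /Defs.rho3_gen E h3_delta // Sa Sb Sc hterm_c !addr0 big1 ?add0r; last first.
  move=> y /andP[_ yN]; apply: hterm0 => S' mS'; have E' := is_E_outer E yN mS'.
  by right; rewrite !(is_E_neq _ _ _ E').
rewrite opprD addrA dS cats1 subrr add0r.
pose T := \sum_(S' | adm false false true false S' && same_out_marks L S S')
    dsaddle b S S' *: \sum_(S1 | adm true false true false S1 && same_out L S' S1)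
      gen S1 (x ++ [:: b]).
transitivity (- T).
  rewrite /hterm -sumrN; apply: eq_big => [S'|S' /eqP mS'].
    by rewrite (mark_make_neg_b _ E) admE.
  have /andP[E' m] : is_E false false true S' && same_out_marks L S S'.
    by rewrite -(mark_make_neg_b _ E) mS'.
  rewrite -scalerN -cats1 -cats1 -catA /=; congr (_ *: _).
  have -> : [:: a; b] = din S' by rewrite (dinE E').
  by rewrite h3E ?h3_gen_mmp //; apply: listing_out m H.
congr (- _); rewrite /T (transfer_sum (Q := same_out_marks L S)
    (k' := saddle_ab s t L S)) //; last first.
  move=> S' S1; rewrite admE // => E' /andP[E1 _] SS1; split=> [|m];
    last exact: saddle_to_Eb.
  apply/idP/idP => m; first exact: same_out_marks_trans m (same_outW SS1).
  by apply: same_out_marks_trans m _; rewrite same_out_marks_sym; apply: same_outW.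
rewrite /to_Eb; apply: eq_big => [S1|S1 _]; last by rewrite cats1.
by rewrite /adm /= eqbF_neg -andbA.
Qed.

(** Collects the double saddle into one coefficient per final state, as in [double_saddle]. *)
Lemma to_EbbE S x : is_E true false true S -> to_Ebb s t L S x =
  \sum_(S1 | adm true false true false S1 && same_out_marks L S S1)
    (\sum_(S' | is_E false true true S' && same_out_marks L S S')
       saddle_ab s t L S S' * saddle_ab s t L S' S1) *: gen S1 (x ++ [:: b]).
Proof.
move=> E; rewrite /to_Ebb /to_Eb; under eq_bigr => S' _ do rewrite scaler_sumr.
rewrite (exchange_big_dep (fun S1 => adm true false true false S1 && same_out_marks
  L S S1)) /=.
  apply: eq_bigr => S1 /andP[A1 m1]; rewrite scaler_suml; apply: eq_big => [S'|S' _].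
    case: (boolP (is_E _ _ _ S' && _)) => //= /andP[E' m'].
    case/andP: A1; rewrite /= eqbF_neg => -> -> /=.
    by apply: same_out_marks_trans m1; rewrite same_out_marks_sym.
  by rewrite scalerA cats1.
move=> S' S1 /andP[_ m'] /and3P[E1 s1 m1]; rewrite /adm E1 eqbF_neg s1 /=.
exact: same_out_marks_trans m' m1.
Qed.

(** For the partner [P] of type [E_{+++}], the saddles at [a] and [c] give [to_Ea] and [to_Ec], and
    the one at [b] gives [S] plus terms with - on the small circle. By [double_saddle] these terms
    and the saddle of [S] at [a] followed by [h3] add up to [to_Ebb]. *)
Lemma homotopy_pmp_plus S : is_E true false true S -> small S -> homotopy_at S.
Proof.
move=> E sm x H; have X := xstate_is_E E isT; have dS := dinE E; rewrite /= in dS.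
have /and3P[/eqP Sa /eqP Sb /eqP Sc] := E.
have AS : adm true false true true S by rewrite /adm E eqb_id.
have [P AP SP] := adm_ex false (isT : xmarks true true true) X.
have [EP _] := andP AP; have /and3P[/eqP Pa /eqP Pb /eqP Pc] := EP.
have dP : din P = [::] by rewrite (dinE EP).
have HP := listing_out (same_outW SP) H.
have PS : same_out L P S by rewrite same_out_sym.
rewrite h3_gen_pmp // (adm_sum _ (isT : xmarks true true true) AP SP) -dP.
rewrite (delta_terms HP) (h3_delta H) Sa Sb Sc Pa Pb Pc hterm_c !addr0.
rewrite /Defs.rho3_gen !(is_E_neq _ _ _ E) Sc sm /=.
have som S' : same_out_marks L P S' = same_out_marks L S S'.
  apply/idP/idP; apply: same_out_marks_trans; last exact: same_outW.
  exact: same_outW.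
have -> : dterm P (x ++ din P) a = to_Ea s t L S x.
  rewrite /to_Ea /dterm dP cats0; apply: eq_big => [S'|S' /eqP mS'].
    by rewrite (mark_make_neg_a _ EP) som.
  have /andP[E' m] : is_E false true true S' && same_out_marks L P S'.
    by rewrite -(mark_make_neg_a _ EP) mS'.
  by rewrite (saddle_to_Ea EP E E' PS m).
have -> : dterm P (x ++ din P) c = to_Ec s t L S x.
  rewrite /to_Ec /dterm dP cats0; apply: eq_big => [S'|S' /eqP mS'].
    by rewrite (mark_make_neg_c _ EP) som.
  have /andP[E' m] : is_E true true false S' && same_out_marks L P S'.
    by rewrite -(mark_make_neg_c _ EP) mS'.
  by rewrite (saddle_to_Ec EP E E' PS m).
have -> : dterm P (x ++ din P) b = gen S (x ++ [:: b]) +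
    \sum_(S1 | adm true false true false S1 && same_out_marks L S S1)
      dsaddle b P S1 *: gen S1 (x ++ [:: b]).
  rewrite /dterm dP cats0 (bigID small) /=; congr (_ + _).
    rewrite -(adm_saddle_sum (k := fun S' => dsaddle b P S')
      (fun S' => gen S' (x ++ [:: b])) (isT : xmarks true false true) AS PS).
      apply: eq_big => [S'|S' _]; last by rewrite cats1.
      by rewrite (mark_make_neg_b _ EP) /adm eqb_id /= andbAC.
    move=> S' /andP[E' s'] m; apply: saddle_b_small => //.
    by move: s'; rewrite /= eqb_id.
  apply: eq_big => [S'|S' _]; last by rewrite cats1.
  by rewrite (mark_make_neg_b _ EP) som /adm eqbF_neg /= andbAC.
(* [k'] is the saddle coefficient at [a], solved for in [double_saddle]. *)
rewrite hterm_a // (transfer_sum (Q := same_out_marks L S)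
  (k' := fun S1 => \sum_(S' | is_E false true true S' && same_out_marks L S S')
       saddle_ab s t L S S' * saddle_ab s t L S' S1 - dsaddle b P S1)) //; last first.
  move=> S' S1; rewrite admE // => E' /andP[E1 s1] SS1; split=> [|m].
    apply/idP/idP => m; first exact: same_out_marks_trans m (same_outW SS1).
    by apply: same_out_marks_trans m _; rewrite same_out_marks_sym; apply: same_outW.
  rewrite /= eqbF_neg in s1.
  have S1S' : same_out L S1 S' by rewrite same_out_sym.
  have m1 := same_out_marks_trans m (same_outW SS1).
  have -> := double_saddle E sm E1 s1 EP E' m1 SP S1S'.
  by rewrite [_ + _ - _]addrC addKr.
have outer : \sum_(y | mark P y && (y \notin [:: a; b; c])) dterm P (x ++ din P) y
    + \sum_(y | mark S y && (y \notin [:: a; b; c])) hterm S (x ++ din S) y = 0.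
  rewrite (eq_bigl (fun y => mark S y && (y \notin [:: a; b; c]))); last first.
    move=> y; case: (boolP (y \in _)); rewrite ?andbF // => yN.
    by rewrite (same_out_mark (same_outW SP)).
  rewrite -big_split big1 //= => y /andP[Sy yN].
  rewrite -[dterm _ _ _]scale1r; apply: (outer_cancel _ _ AS AP SP H yN Sy) => //.
  - by move=> S' x' /andP[E' /=]; rewrite eqb_id => s'; rewrite scale1r h3_gen_pmp // dP.
  - move=> S' x' E'; rewrite /adm E' eqb_id /= => s'.
    by rewrite h3_gen0 ?(negPf s') ?andbF // (is_E_neq _ _ _ E').
  - by rewrite dS dP.
rewrite addrACA outer add0r dS to_EbbE //.
under [X in _ + X]eq_bigr => S1 _ do rewrite scalerBl.
rewrite big_split /= sumrN; set U := \sum_(S1 | _) dsaddle b P S1 *: _.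
set V := \sum_(S1 | _) _ *: gen S1 _; set G := gen S _.
set A := to_Ea _ _ _ _ _; set C := to_Ec _ _ _ _ _.
rewrite !opprD !opprK (addrCA A G) -!addrA; congr (G + (A + _)).
by rewrite (addrA C V) addrCA subrr addr0 addrC.
Qed.

Lemma homotopy_gen S : homotopy_at S.
Proof.
case Sc : (mark S c); last exact: homotopy_c_neg.
case Sa : (mark S a); case Sb : (mark S b).
- by apply: homotopy_ppp; rewrite /Defs.is_E Sa Sb Sc.
- have E : is_E true false true S by rewrite /Defs.is_E Sa Sb Sc.
  by have [sm|ns] := boolP (small S); [apply: homotopy_pmp_plus|apply: homotopy_pmp_minus].
- by apply: homotopy_mpp; rewrite /Defs.is_E Sa Sb Sc.
- by apply: homotopy_mmp; rewrite /Defs.is_E Sa Sb Sc.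
Qed.

Lemma h3_homotopy z :
  delta (h3 z) + h3 (delta z) = z - in_rho3 s t L z.
Proof.
have sumE (f : {linear chain D R -> chain D R}) : f z = \sum_S z S *: f (basis R S).
  by rewrite [in LHS](chain_decomp z) linear_sum; apply: eq_bigr => S _; rewrite linearZ_LR.
rewrite -[delta (h3 z)]/((delta \o h3) z) -[h3 (delta z)]/((h3 \o delta) z).
rewrite (sumE (delta \o h3)) (sumE (h3 \o delta)) (sumE (in_rho3 s t L)).
rewrite [X in _ = X - _]chain_decomp -big_split -sumrB; apply: eq_bigr => S _.
rewrite /= -scalerDr -scalerBr; congr (_ *: _).
(* The formulas hold on sequences with outer crossings before inner ones; up to sign these
   generators are the basis. *)
have H : listing S (out_negs L S ++ din S).
  apply/listing_outP; split; first by rewrite filter_uniq ?enum_uniq.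
  by move=> y; rewrite mem_filter mem_enum [y \in negs S]inE.
have [p _ [_ Eg]] := gen_listing R H.
have -> : basis R S = (-1) ^+ p *: gen S (out_negs L S ++ din S).
  by rewrite Eg scalerA -expr2 sqrr_sign scale1r.
rewrite !linearZ_LR /= -!scalerDr; congr (_ *: _).
by rewrite h3E // in_rho3E //; apply: homotopy_gen.
Qed.

(** * The degree of the homotopy *)

Lemma sigma_make_neg S S' y : mark S y -> mark S' = make_neg (mark S) y ->
  sigma S = sigma S' + 2.
Proof.
move=> Sy mS'; rewrite /sigma (bigD1 y) //= [in RHS](bigD1 y) //= mS' ffunE eqxx Sy /=.
rewrite addrAC; congr (_ + _); apply: eq_bigr => x xy; rewrite ffunE xy.
by [].
Qed.

(** [h3] runs against a change of marker: [S] has the markers obtained from those of any state in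
    its image by making [a], respectively [b], negative. *)
Lemma h3_gen_degree S S' x : h3_gen S x S' != 0 -> sigma S' = sigma S + 2.
Proof.
have sum_neq0 (P : pred (estate D)) l :
    (\sum_(S1 | P S1) gen S1 l) S' != 0 -> P S'.
  apply: contraR => nP; rewrite chain_sumE big1 // => S1 P1; apply: gen_supp.
  by apply: contraNneq nP => ->.
rewrite /Defs.h3_gen; case: ifP => [E|_].
  rewrite ffunE oppr_eq0 => /sum_neq0/and4P[E' _ m _].
  have [/and3P[/eqP Sa _ _] /and3P[/eqP Sa' _ _]] := (E, E').
  apply: (@sigma_make_neg _ _ a); rewrite ?Sa' //; apply/eqP.
  by rewrite (mark_make_neg_a _ E') E same_out_marks_sym.
case: ifP => [/andP[E _]|_]; last by rewrite ffunE eqxx.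
move/sum_neq0/and3P=> [E' m _]; have /and3P[_ /eqP Sb' _] := E'.
apply: (@sigma_make_neg _ _ b); rewrite ?Sb' //; apply/eqP.
by rewrite (mark_make_neg_b _ E') E same_out_marks_sym.
Qed.

Lemma h3_degree i z : in_degree i z -> in_degree (i - 1) (h3 z).
Proof.
move=> zi S; rewrite /Defs.h3 /r3_lift /lin_lift chain_sumE => nz.
have [S0 nS0] : exists S0, (z S0 *: (gen S0 (out_negs L S0 ++ din S0) S0 *:
    h3_gen S0 (out_negs L S0))) S != 0.
  apply/existsP; apply: contraNT nz; rewrite negb_exists => /forallP H.
  by rewrite big1 // => S0 _; apply/eqP; rewrite -[_ == _]negbK.
move: nS0; rewrite !chainZE => n0.
have /zi zS0 : z S0 != 0 by apply: contraNneq n0 => ->; rewrite mul0r.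
have /h3_gen_degree -> : h3_gen S0 (out_negs L S0) S != 0.
  by apply: contraNneq n0 => ->; rewrite !mulr0.
by rewrite mulrBr zS0; ring.
Qed.

End Homotopy.

Theorem theorem4p24 (D : link_diagram) (L : r3_site D) :
  (forall (i : int) (z : chain D ZST), in_degree i z -> in_degree (i - 1) (h3 L z))
  /\ (forall z : chain D ZST,
        delta var_s var_t (h3 L z) + h3 L (delta var_s var_t z)
        = z - in_rho3 var_s var_t L z).
Proof.
by split=> [i z|z]; [apply: h3_degree|apply: h3_homotopy].
Qed.
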